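(* Let $\alpha,\beta$ be two inner functions and let $A$ be a bounded linear operator from $K_\alpha$ into $K_\beta$. Then $A\in\mathscr{T}(\alpha,\beta)$ if and only if $$A-S^*_\beta A S_\alpha=\psi\otimes\widetilde{k}^\alpha_0+\widetilde{k}^\beta_0\otimes\chi$$ for some $\psi\in K_\beta$ and $\chi\in K_\alpha$.
   Context: $H^2$ is the Hardy space of the unit disk $\mathbb{D}$, identified with a closed subspace of $L^2=L^2(\partial\mathbb{D})$ (functions whose Fourier coefficients with negative indices vanish), and $H^\infty$ is the algebra of bounded analytic functions on $\mathbb{D}$. An inner function is $\alpha\in H^\infty$ with $|\alpha|=1$ a.e. on $\partial\mathbb{D}$. The model space associated with $\alpha$ is $K_\alpha=H^2\ominus\alpha H^2$, and $P_\alpha$ is the orthogonal projection from $L^2$ onto $K_\alpha$. The set $K_\alpha^\infty=K_\alpha\cap H^\infty$ is dense in $K_\alpha$. The compressed shift $S_\alpha:K_\alpha\to K_\alpha$ is $S_\alpha f=P_\alpha(zf)$; its adjoint is $S_\alpha^*f(z)=\frac{f(z)-f(0)}{z}$. For $w\in\mathbb{D}$, the reproducing kernel of $K_\alpha$ is $k_w^\alpha(z)=\frac{1-\overline{\alpha(w)}\alpha(z)}{1-\overline{w}z}$, and the conjugate kernel is $\widetilde{k}_w^\alpha=C_\alpha k_w^\alpha\in K_\alpha$, where $C_\alpha f(z)=\alpha(z)\overline{z}\,\overline{f(z)}$ for $|z|=1$; explicitly $\widetilde{k}_w^\alpha(z)=\frac{\alpha(z)-\alpha(w)}{z-w}$,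 so $\widetilde{k}_0^\alpha(z)=\frac{\alpha(z)-\alpha(0)}{z}$. For $\varphi\in L^2$, the asymmetric truncated Toeplitz operator $A_\varphi^{\alpha,\beta}$ from $K_\alpha$ into $K_\beta$ with symbol $\varphi$ is given by $A_\varphi^{\alpha,\beta}f=P_\beta(\varphi f)$; it is densely defined, on $f\in K_\alpha^\infty$, and is called bounded if it extends to a bounded operator $K_\alpha\to K_\beta$ (the extension is denoted by the same symbol). Then $\mathscr{T}(\alpha,\beta)=\{A_\varphi^{\alpha,\beta}:\varphi\in L^2\text{ and }A_\varphi^{\alpha,\beta}\text{ is bounded}\}$. For $x\in K_\beta$, $y\in K_\alpha$, $x\otimes y:K_\alpha\to K_\beta$ is the operator $(x\otimes y)f=\langle f,y\rangle x$, where $\langle\cdot,\cdot\rangle$ is the $L^2$ inner product. *)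

(* Defs.v *)
From HB Require Import structures.
From mathcomp Require Import all_boot all_order all_algebra.
From mathcomp Require Import complex.
From mathcomp Require Import all_classical all_reals all_analysis.

Set Implicit Arguments.
Unset Strict Implicit.
Unset Printing Implicit Defensive.

Import Order.TTheory GRing.Theory Num.Theory.
Import numFieldNormedType.Exports.

Local Open Scope classical_set_scope.
Local Open Scope complex_scope.
Local Open Scope ring_scope.

(* Functions on the disk D and on its boundary are both total functions       *)
(* C -> C. An element of L^2 is a function of which only the values on the    *)
(* unit circle matter, and these only up to a null set: L^2 is not            *)
(* quotiented, and equality of its elements is [eqT]. An element of H^infty   *)
(* carries its values in D together with its boundary values on the circle.   *)

Section Circle.
Variable R : realType.
Local Notation C := R[i].

Lemma twopi_gt0 : (0 : R) < 2 * pi.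
Proof. by rewrite mulr_gt0 ?pi_gt0. Qed.

(* normalized arc length, transported to the angle t in [0, 2 pi] *)
Definition circ : probability (measurableTypeR R) R :=
  uniform_prob twopi_gt0.

Definition expi (t : R) : C := cos t +i* sin t.

Definition eqT (f g : C -> C) : Prop :=
  {ae circ, forall t, f (expi t) = g (expi t)}.

Definition cint (f : C -> C) : C :=
  (\int[circ]_t complex.Re (f (expi t))) +i*
  (\int[circ]_t complex.Im (f (expi t))).

Definition L2 : set (C -> C) :=
  [set f | ((fun t => complex.Re (f (expi t))) \in Lfun circ 2%:E) /\
           ((fun t => complex.Im (f (expi t))) \in Lfun circ 2%:E)].

Definition inner2 (f g : C -> C) : C := cint (fun z => f z * (g z)^*).

Definition norm2 (f : C -> C) : R := Num.sqrt (complex.Re (inner2 f f)).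

Definition fcoef (f : C -> C) (k : int) : C := cint (fun z => f z * z ^ (- k)).

Definition H2 : set (C -> C) :=
  [set f | L2 f /\ forall k : int, k < 0 -> fcoef f k = 0].

(* analytic on D, as the sum of a power series converging on D *)
Definition analyticD (f : C -> C) : Prop :=
  exists a : nat -> C, forall z : C, `|z| < 1 ->
    series (fun n => a n * z ^+ n : C^o) @ \oo --> (f z : C^o).

(* bounded analytic functions on D, together with their boundary values,      *)
(* which are the radial limits                                                *)
Definition Hinf : set (C -> C) :=
  [set f | [/\ analyticD f,
               exists M : R, forall z : C, `|z| < 1 -> `|f z| <= M%:C &
               {ae circ, forall t,
                 (f (r%:C * expi t) : C^o) @[r --> (1 : R)^'-]
                   --> (f (expi t) : C^o)}]].

Definition inner_function (alpha : C -> C) : Prop :=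
  Hinf alpha /\ {ae circ, forall t, `|alpha (expi t)| = 1}.

Definition ominus (V W : set (C -> C)) : set (C -> C) :=
  [set f | V f /\ forall g, W g -> inner2 f g = 0].

Definition model_space (alpha : C -> C) : set (C -> C) :=
  ominus H2 [set alpha \* h | h in H2].

Definition model_space_inf (alpha : C -> C) : set (C -> C) :=
  model_space alpha `&` [set f | exists2 F, Hinf F & eqT f F].

(* [orthproj V f] and [adjoint_on V T g] are defined up to [eqT] by their     *)
(* universal property; 0 is a default value if there is no such element       *)
Definition orthproj (V : set (C -> C)) (f : C -> C) : C -> C :=
  xget 0 [set g | V g /\ forall h, V h -> inner2 (f \- g) h = 0].

Definition adjoint_on (V : set (C -> C)) (T : (C -> C) -> (C -> C))
    (g : C -> C) : C -> C :=
  xget 0 [set h | V h /\ forall f, V f -> inner2 (T f) g = inner2 f h].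

(* T represents a bounded linear operator from V into W; only the restriction *)
(* of T to V is relevant. By the last two clauses T respects eqT on V.        *)
Definition bounded_operator (V W : set (C -> C))
    (T : (C -> C) -> (C -> C)) : Prop :=
  [/\ forall f, V f -> W (T f),
      forall (c : C) f g, V f -> V g ->
        eqT (T (fun z => c * f z + g z)) (fun z => c * T f z + T g z) &
      exists M : R, forall f, V f -> norm2 (T f) <= M * norm2 f].

Definition eq_operator_on (V : set (C -> C)) (T U : (C -> C) -> (C -> C)) :=
  forall f, V f -> eqT (T f) (U f).

Definition tensor (x y : C -> C) (f : C -> C) : C -> C :=
  fun z => inner2 f y * x z.

Definition cshift (alpha : C -> C) (f : C -> C) : C -> C :=
  orthproj (model_space alpha) (fun z => z * f z).

Definition cshift_adj (alpha : C -> C) : (C -> C) -> (C -> C) :=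
  adjoint_on (model_space alpha) (cshift alpha).

Definition kernel_fun (alpha : C -> C) (w : C) : C -> C :=
  fun z => (1 - (alpha w)^* * alpha z) / (1 - w^* * z).

Definition conj_op (alpha : C -> C) (f : C -> C) : C -> C :=
  fun z => alpha z * z^* * (f z)^*.

Definition conj_kernel (alpha : C -> C) (w : C) : C -> C :=
  conj_op alpha (kernel_fun alpha w).

Definition atto (beta phi : C -> C) (f : C -> C) : C -> C :=
  orthproj (model_space beta) (phi \* f).

(* the bounded operators extending some [atto beta phi], phi in L^2, from     *)
(* the dense domain of the latter                                             *)
Definition TTO (alpha beta : C -> C) : set ((C -> C) -> (C -> C)) :=
  [set A | bounded_operator (model_space alpha) (model_space beta) A /\
     exists2 phi, L2 phi &
       eq_operator_on (model_space_inf alpha) A (atto beta phi)].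

End Circle.

(* Main.v *)
(* Fix inner functions alpha, beta. On K_alpha the compressed shift is
   S f = z f - a(f) alpha with a(f) = <z f, alpha> = <f, k~_0^alpha>, so the
   operator identity is equivalent to
     (W)  <A f, g> - <A S f, S g> = a(f) <psi, g> + <f, chi> conj(b(g))
   for all f in K_alpha, g in K_beta (b(g) = <g, k~_0^beta>).  If A has symbol
   phi, (W) is a direct computation for bounded f, with
   psi = P_beta(conj z phi alpha) - <phi alpha, beta> k~_0^beta and
   chi = P_alpha(conj phi conj z beta), and it extends to K_alpha by density.
   Conversely iterate (W): <A f, g> is the sum over k < n of
   a(S^k f) <psi, z^k g> + <z^k f, chi> conj(b(S^k g)), plus <A S^n f, S^n g>.
   Since conj(a(S^k f)) is the k-th Fourier coefficient of
   C_alpha f = alpha conj(z f), which lies in H^2, |S^n f|^2 is the tail of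
   Parseval's sum and tends to 0, while for bounded f and g the sums converge
   to <phi f, g> with phi = conj(alpha) z psi + beta conj(z chi).

   The boundary values of alpha need not be measurable on a null set, so alpha
   is first replaced by a measurable, everywhere unimodular representative;
   this is harmless because the integral ignores null sets even for
   nonmeasurable functions. *)

Require Import Defs.
From mathcomp Require Import all_boot all_order all_algebra.
From mathcomp Require Import complex.
From mathcomp Require Import all_classical all_reals all_analysis.
From mathcomp Require Import measurable_realfun.
From mathcomp Require Import ring lra.

Set Implicit Arguments.
Unset Strict Implicit.
Unset Printing Implicit Defensive.

Import Order.TTheory GRing.Theory Num.Theory.
Import numFieldNormedType.Exports.

Local Open Scope classical_set_scope.
Local Open Scope complex_scope.
Local Open Scope ring_scope.

(** * Integrals of almost everywhere equal functions *)

(** Boundedness of f and g is forced twice: phi f lies in L^2 only for bounded f, and the sums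
    become pairings of Fourier coefficients only once the bounded factor has changed sides, as in
    <psi, z^k g> = <conj(g) psi, z^k>. In the limit they are <conj(g) psi, C_alpha f> and <C_beta g,
    conj(f) chi>; written as integrals against f conj(g), these display the two summands of phi. In
    the remainder only |S^n f| has to vanish, since S is a contraction on the side of g. The Hilbert
    space facts behind this are built on the circle itself. Convergence of Fourier sums in H^2
    combines completeness of L^2 with uniqueness of Fourier coefficients, and uniqueness comes from
    trigonometric polynomials that approximate indicators of arcs. The projection onto K_alpha is f
    -> P_+ f - alpha P_+(conj(alpha) f), where P_+ projects onto H^2. Density of bounded functions
    holds because the projection of z^n is S^n applied to the kernel 1 - conj(alpha(0)) alpha, a
    bounded function, so that polynomials project to bounded functions. *)

Section AlmostEverywhere.
Context d (T : measurableType d) (R : realType).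
Variable mu : {measure set T -> \bar R}.

Import HBNNSimple.

(* No measurability: mathcomp's integral of a nonnegative function is a
   supremum over simple functions below it. *)
Lemma ge0_ae_le_integralT (f g : T -> \bar R) :
  (forall x, 0 <= f x)%E -> (forall x, 0 <= g x)%E ->
  {ae mu, forall x, f x = g x} ->
  (\int[mu]_x f x <= \int[mu]_x g x)%E.
Proof.
move=> f0 g0 [N [mN N0 subN]].
rewrite ge0_integralTE// [leRHS]ge0_integralTE//.
apply: ge_ereal_sup => _ [h /= hf <-].
have mNc : measurable (~` N) by exact: measurableC.
(* Cut off on the null set [N], the simple function keeps its integral and now lies below [g]
   everywhere. *)
pose h' : {nnsfun T >-> R} := proj_nnsfun h mNc.
have h'E x : h' x = h x * \1_(~` N) x by [].
apply: (@le_trans _ _ (sintegral mu h')).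
  rewrite -!integralT_nnsfun.
  rewrite le_eqVlt; apply/orP; left; apply/eqP.
  apply: ge0_ae_eq_integral => //.
  - by apply/measurable_EFinP; exact: measurable_funP.
  - by apply/measurable_EFinP; exact: measurable_funP.
  - by move=> x _; rewrite lee_fin.
  - by move=> x _; rewrite lee_fin.
  exists N; split => //= x /= hx; apply: contrapT => Nx; apply: hx => _.
  by apply/esym; congr EFin; rewrite [LHS]h'E indicE mem_set// mulr1.
apply: ereal_sup_ubound; exists h' => //= x.
rewrite [X in X%:E]h'E indicE; have [xN|xN] := boolP (x \in ~` N).
  rewrite mulr1 (le_trans (hf x))// le_eqVlt; apply/orP; left; apply/eqP.
  apply: contrapT => fg; move: xN; rewrite inE; apply; exact: subN.
by rewrite mulr0 g0.
Qed.

Lemma ae_eq_integralT (f g : T -> \bar R) :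
  {ae mu, forall x, f x = g x} -> (\int[mu]_x f x = \int[mu]_x g x)%E.
Proof.
move=> fg; rewrite integralE [RHS]integralE.
have fgp : {ae mu, forall x, (f^\+ x = g^\+ x)%E}.
  by apply: filterS fg => x fgx; rewrite !funeposE fgx.
have fgn : {ae mu, forall x, (f^\- x = g^\- x)%E}.
  by apply: filterS fg => x fgx; rewrite !funenegE fgx.
by congr (_ - _)%E; apply/eqP; rewrite eq_le; apply/andP; split;
  apply: ge0_ae_le_integralT => //; [apply: filterS fgp|apply: filterS fgn].
Qed.

Lemma aeS (A B : T -> Prop) : (forall t, A t -> B t) ->
  {ae mu, forall t, A t} -> {ae mu, forall t, B t}.
Proof.
by move=> AB [N [mN N0 AN]]; exists N; split => // t /= Bt; apply: AN => /= /AB.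
Qed.

Lemma aeI (A B : T -> Prop) :
  {ae mu, forall t, A t} -> {ae mu, forall t, B t} ->
  {ae mu, forall t, A t /\ B t}.
Proof.
move=> hA hB; have := negligibleU hA hB; apply: negligibleS => t /= h.
by apply: contrapT => /not_orP[/contrapT ? /contrapT ?]; apply: h.
Qed.

End AlmostEverywhere.

(** * Complex integrals over the circle *)

Section CircleIntegral.
Variable R : realType.
Local Notation C := R[i].
Local Notation P := (circ R).
Local Notation Re := complex.Re.
Local Notation Im := complex.Im.
Implicit Types (f g h : C -> C) (z w : C) (t : R).

Lemma norm_expi t : `|expi t| = 1.
Proof. by rewrite normc_def/= cos2Dsin2 sqrtr1. Qed.

Lemma expi_neq0 t : expi t != 0.
Proof. by rewrite -normr_eq0 norm_expi oner_eq0. Qed.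

Lemma conj_unimodular z : `|z| = 1 -> z^* = z^-1.
Proof. by move=> z1; rewrite invc_norm z1 expr1n invr1 mul1r. Qed.

Lemma conj_expi t : (expi t)^* = (expi t)^-1.
Proof. exact/conj_unimodular/norm_expi. Qed.

Lemma ReM z w : Re (z * w) = Re z * Re w - Im z * Im w.
Proof. by case: z w => [a b] [c d]. Qed.

Lemma ImM z w : Im (z * w) = Re z * Im w + Im z * Re w.
Proof. by case: z w => [a b] [c d] /=; rewrite addrC (mulrC b). Qed.

Lemma ReD z w : Re (z + w) = Re z + Re w. Proof. by case: z w => [a b] [c d]. Qed.
Lemma ImD z w : Im (z + w) = Im z + Im w. Proof. by case: z w => [a b] [c d]. Qed.
Lemma ReN z : Re (- z) = - Re z. Proof. by case: z. Qed.
Lemma ImN z : Im (- z) = - Im z. Proof. by case: z. Qed.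
Lemma Re_conj z : Re z^* = Re z. Proof. by case: z. Qed.
Lemma Im_conj z : Im z^* = - Im z. Proof. by case: z. Qed.

Lemma cjK z : z^*^* = z. Proof. exact: conjcK. Qed.
Lemma cjM z w : (z * w)^* = z^* * w^*. Proof. exact: rmorphM. Qed.
Lemma cjD z w : (z + w)^* = z^* + w^*. Proof. exact: rmorphD. Qed.
Lemma cjN z : (- z)^* = - z^*. Proof. exact: rmorphN. Qed.
Lemma cj0 : (0 : C)^* = 0. Proof. exact: rmorph0. Qed.
Lemma cj1 : (1 : C)^* = 1. Proof. exact: rmorph1. Qed.

(** The squared modulus as an element of [R], ready for real integrals; the norm of [R[i]] takes its
    values in [R[i]]. *)
Definition sqn z : R := Re z ^+ 2 + Im z ^+ 2.

Lemma sqn_ge0 z : 0 <= sqn z.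
Proof. by rewrite addr_ge0 ?sqr_ge0. Qed.

Lemma sqnM z w : sqn (z * w) = sqn z * sqn w.
Proof. by rewrite /sqn ReM ImM; ring. Qed.

Lemma sqn_conj z : sqn z^* = sqn z.
Proof. by rewrite /sqn Re_conj Im_conj sqrrN. Qed.

Lemma sqnD_le z w : sqn (z + w) <= 2 * (sqn z + sqn w).
Proof.
rewrite /sqn ReD ImD.
have := sqr_ge0 (Re z - Re w); have := sqr_ge0 (Im z - Im w); nra.
Qed.

Lemma sqnE z : (sqn z)%:C = `|z| ^+ 2.
Proof. by rewrite -add_Re2_Im2. Qed.

Lemma sqn_eq0 z : sqn z = 0 -> z = 0.
Proof. by move=> h; apply/eqP; rewrite -normr_eq0 -sqrf_eq0 -sqnE h. Qed.

Lemma sqn_unimodular z : `|z| = 1 -> sqn z = 1.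
Proof. by move=> z1; have := sqnE z; rewrite z1 expr1n => /complexI. Qed.

Lemma mulcJ z : z * z^* = (sqn z)%:C.
Proof. by rewrite sqnE sqr_normc. Qed.

Lemma normr_Re_mul_le z w : `|Re (z * w)| <= sqn z + sqn w.
Proof.
rewrite ReM /sqn ler_norml; have := sqr_ge0 (Re z - Re w).
have := sqr_ge0 (Re z + Re w); have := sqr_ge0 (Im z - Im w).
have := sqr_ge0 (Im z + Im w); nra.
Qed.

Lemma normr_Im_mul_le z w : `|Im (z * w)| <= sqn z + sqn w.
Proof.
rewrite ImM /sqn ler_norml; have := sqr_ge0 (Re z - Im w).
have := sqr_ge0 (Re z + Im w); have := sqr_ge0 (Im z - Re w).
have := sqr_ge0 (Im z + Re w); nra.
Qed.

Definition cmeas f :=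
  measurable_fun [set: measurableTypeR R] (fun t => Re (f (expi t))) /\
  measurable_fun [set: measurableTypeR R] (fun t => Im (f (expi t))).

Lemma cmeas_cst c : cmeas (cst c).
Proof. by split; exact: measurable_cst. Qed.

Lemma cmeasD f g : cmeas f -> cmeas g -> cmeas (f + g).
Proof.
move=> [fr fi] [gr gi]; split.
- under eq_fun do rewrite ReD; exact: measurable_funD.
- under eq_fun do rewrite ImD; exact: measurable_funD.
Qed.

Lemma cmeasM f g : cmeas f -> cmeas g -> cmeas (f * g).
Proof.
move=> [fr fi] [gr gi]; split.
- by under eq_fun do rewrite ReM; apply: measurable_funB; apply: measurable_funM.
- by under eq_fun do rewrite ImM; apply: measurable_funD; apply: measurable_funM.
Qed.

Definition conjf f : C -> C := fun z => (f z)^*.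

Lemma cmeas_conj f : cmeas f -> cmeas (conjf f).
Proof.
move=> [fr fi]; split.
- by under eq_fun do rewrite Re_conj.
- under eq_fun do rewrite Im_conj; exact: measurableT_comp.
Qed.

Lemma cmeas_eq f g : (forall t, f (expi t) = g (expi t)) -> cmeas f -> cmeas g.
Proof. by move=> fg [fr fi]; split; under eq_fun do rewrite -fg. Qed.

Lemma cmeas_id : cmeas id.
Proof.
split => /=; apply: continuous_measurable_fun.
- exact: continuous_cos.
- exact: continuous_sin.
Qed.

Lemma cmeasX f n : cmeas f -> cmeas (f ^+ n).
Proof.
move=> mf; elim: n => [|n ih]; first by rewrite expr0; exact: (cmeas_cst 1).
by rewrite exprS; exact: cmeasM.
Qed.

Lemma cmeas_sqn f : cmeas f ->
  measurable_fun [set: measurableTypeR R] (fun t => sqn (f (expi t))).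
Proof. by move=> [fr fi]; apply: measurable_funD; exact: measurable_funX. Qed.

Definition L1 f :=
  P.-integrable setT (fun t => (Re (f (expi t)))%:E) /\
  P.-integrable setT (fun t => (Im (f (expi t)))%:E).

Lemma L1_le f (b : R -> R) : cmeas f ->
  P.-integrable setT (fun t => (b t)%:E) ->
  (forall t, `|Re (f (expi t))| <= b t) ->
  (forall t, `|Im (f (expi t))| <= b t) -> L1 f.
Proof.
move=> [fr fi] ib br bi; split; apply: le_integrable ib => //.
- exact/measurable_EFinP.
- by move=> t _ /=; rewrite lee_fin (le_trans (br t))// ler_norm.
- exact/measurable_EFinP.
- by move=> t _ /=; rewrite lee_fin (le_trans (bi t))// ler_norm.
Qed.

Lemma cint_ae f g : eqT f g -> cint f = cint g.
Proof.
move=> fg; rewrite /cint /Rintegral; congr (_ +i* _); congr fine;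
  by apply: ae_eq_integralT; apply: aeS fg => t /= ->.
Qed.

Lemma eqT_on f g : (forall t, f (expi t) = g (expi t)) -> eqT f g.
Proof. by move=> fg; apply: aeW. Qed.

Lemma cint_on f g : (forall t, f (expi t) = g (expi t)) -> cint f = cint g.
Proof. by move=> fg; apply/cint_ae/eqT_on. Qed.

Lemma cintD f g : L1 f -> L1 g -> cint (f + g) = cint f + cint g.
Proof.
move=> [fr fi] [gr gi]; rewrite /cint.
under eq_Rintegral do rewrite ReD.
under [X in _ +i* X]eq_Rintegral do rewrite ImD.
by rewrite !RintegralD.
Qed.

Lemma integrable_realZ c (b : R -> R) : P.-integrable setT (fun t => (b t)%:E) ->
  P.-integrable setT (EFin \o (fun t => c * b t)).
Proof. by move=> ib; rewrite /comp; under eq_fun do rewrite EFinM; apply: integrableZl. Qed.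

Lemma cvg_EFinT (u : nat -> R) (l : R) :
  u n @[n --> \oo] --> l -> (u n)%:E @[n --> \oo] --> l%:E.
Proof. by move=> ul; apply/fine_cvgP; split; [exact: nearW|]. Qed.

Lemma cintZ c f : L1 f -> cint (cst c * f) = c * cint f.
Proof.
move=> [fr fi]; rewrite /cint.
under eq_Rintegral do rewrite ReM.
under [X in _ +i* X]eq_Rintegral do rewrite ImM.
rewrite RintegralB//; [|exact: integrable_realZ|exact: integrable_realZ].
rewrite RintegralD//; [|exact: integrable_realZ|exact: integrable_realZ].
rewrite !RintegralZl//.
by case: c => a b; congr (_ +i* _); rewrite /= addrC (mulrC b) mulrC.
Qed.

Lemma cint_conj f : L1 f -> cint (conjf f) = (cint f)^*.
Proof.
move=> [fr fi]; rewrite /cint.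
under eq_Rintegral do rewrite Re_conj.
under [X in _ +i* X]eq_Rintegral do rewrite Im_conj -mulN1r.
by rewrite RintegralZl//= mulN1r.
Qed.

Lemma Rintegral_dominated (u_ : nat -> R -> R) (u b : R -> R) :
  (forall n, measurable_fun [set: measurableTypeR R] (u_ n)) ->
  measurable_fun [set: measurableTypeR R] u ->
  {ae P, forall t, u_ n t @[n --> \oo] --> u t} ->
  P.-integrable setT (fun t => (b t)%:E) ->
  {ae P, forall t, forall n, `|u_ n t| <= b t} ->
  P.-integrable setT (fun t => (u t)%:E) /\
  (\int[P]_t u_ n t @[n --> \oo] --> \int[P]_t u t).
Proof.
move=> mu_ mu cu ib ub.
have [|||||ir _ cr] := @dominated_convergence _ _ R P setT measurableT
    (fun n t => (u_ n t)%:E) (fun t => (u t)%:E) (EFin \o b).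
- by move=> n; apply/measurable_EFinP.
- exact/measurable_EFinP.
- by apply: aeS cu => t h _; apply: cvg_EFinT.
- exact: ib.
- by apply: aeS ub => t h n _; rewrite /= lee_fin.
split => //; apply: fine_cvg; rewrite fineK//; exact: integrable_fin_num.
Qed.

Lemma cint_dominated (f_ : nat -> C -> C) f (b : R -> R) :
  (forall n, cmeas (f_ n)) -> cmeas f ->
  {ae P, forall t, Re (f_ n (expi t)) @[n --> \oo] --> Re (f (expi t)) /\
                   Im (f_ n (expi t)) @[n --> \oo] --> Im (f (expi t))} ->
  P.-integrable setT (fun t => (b t)%:E) ->
  {ae P, forall t, forall n, `|Re (f_ n (expi t))| <= b t /\
                             `|Im (f_ n (expi t))| <= b t} ->
  [/\ L1 f,
      Re (cint (f_ n)) @[n --> \oo] --> Re (cint f) &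
      Im (cint (f_ n)) @[n --> \oo] --> Im (cint f)].
Proof.
move=> mf_ mf cf ib fb.
have [fr fi] := mf.
have [|||||ir cr] := @Rintegral_dominated (fun n t => Re (f_ n (expi t)))
  (fun t => Re (f (expi t))) b.
- by move=> n; exact: (mf_ n).1.
- by [].
- by apply: aeS cf => t [].
- by [].
- by apply: aeS fb => t h n; exact: (h n).1.
have [|||||ii ci] := @Rintegral_dominated (fun n t => Im (f_ n (expi t)))
  (fun t => Im (f (expi t))) b.
- by move=> n; exact: (mf_ n).2.
- by [].
- by apply: aeS cf => t [].
- by [].
- by apply: aeS fb => t h n; exact: (h n).2.
by [].
Qed.

End CircleIntegral.

(** * Square integrable functions *)

Section SquareIntegrable.
Variable R : realType.
Local Notation C := R[i].
Local Notation P := (circ R).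
Local Notation Re := complex.Re.
Implicit Types (f g h b : C -> C) (c z w : C) (t : R).

Lemma Lfun2P (u : measurableTypeR R -> R) : u \in Lfun P 2%:E <->
  measurable_fun setT u /\ P.-integrable setT (fun t => (u t ^+ 2)%:E).
Proof.
split=> [u2|[mu iu]].
  split; last exact: Lfun2_integrable_sqr.
  by move: u2 => /[!inE] /andP[/[!inE]/= mu _].
rewrite inE; apply/andP; split; rewrite inE//=.
rewrite /finite_norm unlock /= ; apply: poweR_lty.
have /integrableP[_] := iu.
apply: le_lt_trans; rewrite le_eqVlt; apply/orP; left; apply/eqP.
apply: eq_integral => t _ /=.
by rewrite powR_mulrn// normrX.
Qed.

Lemma L2P f : L2 f <->
  cmeas f /\ P.-integrable setT (fun t => (sqn (f (expi t)))%:E).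
Proof.
split=> [[/Lfun2P[mr ir] /Lfun2P[mi ii]]|[[mr mi] i2]].
  by split=> //; under eq_fun do rewrite /sqn EFinD; apply: integrableD.
split; apply/Lfun2P; split => //; apply: le_integrable i2 => //.
- by apply/measurable_EFinP; exact: measurable_funX.
- move=> t _ /=; rewrite lee_fin !ger0_norm ?sqn_ge0 ?sqr_ge0//.
  by rewrite lerDl sqr_ge0.
- by apply/measurable_EFinP; exact: measurable_funX.
- move=> t _ /=; rewrite lee_fin !ger0_norm ?sqn_ge0 ?sqr_ge0//.
  by rewrite lerDr sqr_ge0.
Qed.

Lemma L2_cmeas f : L2 f -> cmeas f. Proof. by case/L2P. Qed.

Lemma L2_le f (b : R -> R) : cmeas f ->
  P.-integrable setT (fun t => (b t)%:E) ->
  {ae P, forall t, sqn (f (expi t)) <= b t} -> L2 f.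
Proof.
move=> mf ib fb; apply/L2P; split => //; apply/integrableP; split.
  by apply/measurable_EFinP; exact: cmeas_sqn.
have /integrableP[mb ltb] := ib.
apply: le_lt_trans ltb; apply: ae_ge0_le_integral => //.
- by apply: measurableT_comp => //; apply/measurable_EFinP; exact: cmeas_sqn.
- exact: measurableT_comp.
- apply: aeS fb => t ft _ /=.
  by rewrite lee_fin ger0_norm ?sqn_ge0// (le_trans ft)// ler_norm.
Qed.

Lemma L2D f g : L2 f -> L2 g -> L2 (f + g).
Proof.
move=> /L2P[mf f2] /L2P[mg g2].
apply: (@L2_le _ (fun t => 2 * (sqn (f (expi t)) + sqn (g (expi t))))).
- exact: cmeasD.
- by apply: integrable_realZ; under eq_fun do rewrite EFinD; apply: integrableD.
- by apply: aeW => t; exact: sqnD_le.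
Qed.

(** These functions act on L^2 by multiplication. The bound is only almost everywhere because the
    boundary values of a bounded analytic function are controlled only where the radial limit
    exists. *)
Definition bdd b := cmeas b /\
  exists M : R, {ae P, forall t, sqn (b (expi t)) <= M}.

Lemma L2M b f : bdd b -> L2 f -> L2 (b * f).
Proof.
move=> [mb [M bM]] /L2P[mf f2].
apply: (@L2_le _ (fun t => M * sqn (f (expi t)))).
- exact: cmeasM.
- exact: integrable_realZ.
- by apply: aeS bM => t bM; rewrite sqnM ler_wpM2r// sqn_ge0.
Qed.

Lemma bdd_cst c : bdd (cst c).
Proof. by split; [exact: cmeas_cst|exists (sqn c); apply: aeW]. Qed.

Lemma bddM f g : bdd f -> bdd g -> bdd (f * g).
Proof.
move=> [mf [M fM]] [mg [N gN]]; split; first exact: cmeasM.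
exists (M * N); apply: aeS (aeI fM gN) => t [fMt gNt].
by rewrite sqnM ler_pM// sqn_ge0.
Qed.

Lemma bddD f g : bdd f -> bdd g -> bdd (f + g).
Proof.
move=> [mf [M fM]] [mg [N gN]]; split; first exact: cmeasD.
exists (2 * (M + N)); apply: aeS (aeI fM gN) => t [fMt gNt].
by rewrite (le_trans (sqnD_le _ _))// ler_pM2l// lerD.
Qed.

Lemma bdd_conj f : bdd f -> bdd (conjf f).
Proof.
move=> [mf [M fM]]; split; first exact: cmeas_conj.
by exists M; apply: aeS fM => t; rewrite sqn_conj.
Qed.

Lemma bdd_unimodular f : cmeas f -> (forall t, `|f (expi t)| = 1) -> bdd f.
Proof.
by move=> mf f1; split=> //; exists 1; apply: aeW => t; rewrite sqn_unimodular.
Qed.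

Lemma bdd_id : bdd id.
Proof. by apply: bdd_unimodular; [exact: cmeas_id|exact: norm_expi]. Qed.

Lemma L2_cst c : L2 (cst c : C -> C).
Proof.
apply: (@L2_le _ (fun=> sqn c)); [exact: cmeas_cst| |exact: aeW].
exact: finite_measure_integrable_cst.
Qed.

Lemma bdd_L2 f : bdd f -> L2 f.
Proof. by move=> bf; rewrite -[f]mulr1; apply: L2M => //; exact: (L2_cst 1). Qed.

Lemma L2Z c f : L2 f -> L2 (cst c * f).
Proof. by apply: L2M; exact: bdd_cst. Qed.

Lemma L2N f : L2 f -> L2 (- f).
Proof.
move=> f2; rewrite (_ : - f = cst (-1) * f); first exact: L2Z.
by apply/funext => z /=; rewrite !fctE/= mulN1r.
Qed.

Lemma L2B f g : L2 f -> L2 g -> L2 (f - g).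
Proof. by move=> f2 g2; apply: L2D => //; exact: L2N. Qed.

Lemma L2_conj f : L2 f -> L2 (conjf f).
Proof.
move=> /L2P[mf f2]; apply/L2P; split; first exact: cmeas_conj.
by under eq_fun do rewrite sqn_conj.
Qed.

Lemma L2_mulL1 f g : L2 f -> L2 g -> L1 (f * g).
Proof.
move=> /L2P[mf f2] /L2P[mg g2].
apply: (@L1_le _ _ (fun t => sqn (f (expi t)) + sqn (g (expi t)))).
- exact: cmeasM.
- by under eq_fun do rewrite EFinD; apply: integrableD.
- by move=> t; exact: normr_Re_mul_le.
- by move=> t; exact: normr_Im_mul_le.
Qed.

Lemma L2_L1 f : L2 f -> L1 f.
Proof. by move=> f2; rewrite -[f]mulr1; apply: L2_mulL1 => //; exact: (L2_cst 1). Qed.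

Lemma ipE f g : inner2 f g = cint (f * conjf g). Proof. by []. Qed.

Lemma ip_ae f f' g g' : eqT f f' -> eqT g g' -> inner2 f g = inner2 f' g'.
Proof.
move=> ff' gg'; apply: cint_ae; apply: aeS (aeI ff' gg') => t [].
by move=> -> ->.
Qed.

Lemma ip_on f f' g g' :
  (forall t, f (expi t) * (g (expi t))^* = f' (expi t) * (g' (expi t))^*) ->
  inner2 f g = inner2 f' g'.
Proof. by move=> e; apply: cint_on. Qed.

Lemma ipDl f g h : L2 f -> L2 g -> L2 h ->
  inner2 (f + g) h = inner2 f h + inner2 g h.
Proof.
move=> f2 g2 h2; rewrite !ipE mulrDl cintD//;
  by apply: L2_mulL1 => //; exact: L2_conj.
Qed.

Lemma ipZl c f g : L2 f -> L2 g -> inner2 (cst c * f) g = c * inner2 f g.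
Proof.
by move=> f2 g2; rewrite !ipE -mulrA cintZ//; apply: L2_mulL1 => //; exact: L2_conj.
Qed.

Lemma ipC f g : L2 f -> L2 g -> inner2 g f = (inner2 f g)^*.
Proof.
move=> f2 g2; rewrite !ipE -cint_conj; last by apply: L2_mulL1 => //; exact: L2_conj.
by apply: cint_on => t; rewrite /conjf !fctE cjM cjK mulrC.
Qed.

Lemma ipDr f g h : L2 f -> L2 g -> L2 h ->
  inner2 f (g + h) = inner2 f g + inner2 f h.
Proof.
move=> f2 g2 h2; rewrite ipC//; last exact: L2D.
by rewrite ipDl// cjD -!ipC.
Qed.

Lemma ipZr c f g : L2 f -> L2 g -> inner2 f (cst c * g) = c^* * inner2 f g.
Proof.
move=> f2 g2; rewrite ipC//; last exact: L2Z.
by rewrite ipZl// cjM -ipC.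
Qed.

Lemma ipNl f g : L2 f -> L2 g -> inner2 (- f) g = - inner2 f g.
Proof.
move=> f2 g2; rewrite (_ : - f = cst (-1) * f) ?ipZl ?mulN1r//.
Qed.

Lemma ipNr f g : L2 f -> L2 g -> inner2 f (- g) = - inner2 f g.
Proof.
by move=> f2 g2; rewrite ipC ?ipNl ?cjN -?ipC//; exact: L2N.
Qed.

Lemma ipBl f g h : L2 f -> L2 g -> L2 h ->
  inner2 (f - g) h = inner2 f h - inner2 g h.
Proof. by move=> f2 g2 h2; rewrite ipDl ?ipNl//; exact: L2N. Qed.

Lemma ipBr f g h : L2 f -> L2 g -> L2 h ->
  inner2 f (g - h) = inner2 f g - inner2 f h.
Proof. by move=> f2 g2 h2; rewrite ipDr ?ipNr//; exact: L2N. Qed.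

Lemma ip0l f : inner2 0 f = 0.
Proof.
rewrite ipE mul0r; have := @cintZ R 0 0; rewrite mulr0 mul0r; apply.
by apply: L2_L1; exact: L2_cst.
Qed.

Lemma ip0r f : inner2 f 0 = 0.
Proof.
by rewrite -(ip0l 0); apply: ip_on => t; have -> : (0 : C -> C) (expi t) = 0 by []; rewrite mul0r cj0 mulr0.
Qed.

Definition nsq f : R := Re (inner2 f f).

Lemma nsqE f : nsq f = \int[P]_t sqn (f (expi t)).
Proof. by rewrite /nsq /inner2 /cint/=; under eq_Rintegral do rewrite mulcJ. Qed.

Lemma nsq_ge0 f : 0 <= nsq f.
Proof. by rewrite nsqE Rintegral_ge0// => t _; exact: sqn_ge0. Qed.

Lemma ip_self f : L2 f -> inner2 f f = (nsq f)%:C.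
Proof.
move=> f2; rewrite /nsq; have := ipC f2 f2.
case: (inner2 f f) => a b /= [] /eqP; rewrite -subr_eq0 opprK -mulr2n mulrn_eq0/=.
by move=> /eqP ->.
Qed.

Lemma nsq_ae f g : eqT f g -> nsq f = nsq g.
Proof. by move=> fg; rewrite /nsq (ip_ae fg fg). Qed.

Lemma nsq0_eqT f : L2 f -> nsq f = 0 -> eqT f 0.
Proof.
move=> /L2P[mf f2]; rewrite nsqE => f0.
have : (\int[P]_t `|(sqn (f (expi t)))%:E| = 0)%E.
  rewrite -[RHS]/(0%:E) -f0 /Rintegral fineK; last exact: integrable_fin_num.
  by apply: eq_integral => t _; rewrite gee0_abs// lee_fin sqn_ge0.
move=> /ae_eq_integral_abs; move=> /(_ measurableT).
have m2 : measurable_fun setT (fun t => (sqn (f (expi t)))%:E : \bar R).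
  by apply/measurable_EFinP; exact: cmeas_sqn.
move=> /(_ m2) /=; apply: aeS => t /(_ I) [] /sqn_eq0; exact.
Qed.

Lemma eqT_refl f : eqT f f. Proof. exact: eqT_on. Qed.

Lemma eqT_sym f g : eqT f g -> eqT g f.
Proof. by apply: aeS => t ->. Qed.

Lemma eqT_trans f g h : eqT f g -> eqT g h -> eqT f h.
Proof. by move=> fg gh; apply: aeS (aeI fg gh) => t [-> ->]. Qed.

Lemma eqT_ip f g : L2 f -> L2 g ->
  (inner2 (f - g) f = inner2 (f - g) g) -> eqT f g.
Proof.
move=> f2 g2 e; have d2 := L2B f2 g2.
have : nsq (f - g) = 0 by rewrite /nsq ipBr// e subrr.
move=> /nsq0_eqT => /(_ d2); apply: aeS => t /eqP.
by rewrite !fctE subr_eq0 => /eqP.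
Qed.

Lemma nsqZ c f : L2 f -> nsq (cst c * f) = sqn c * nsq f.
Proof.
move=> f2; rewrite {1}/nsq ipZl ?ipZr//; last exact: L2Z.
by rewrite mulrA mulcJ ip_self// -rmorphM.
Qed.

Lemma nsqN f : L2 f -> nsq (- f) = nsq f.
Proof. by move=> f2; rewrite /nsq ipNl ?ipNr ?opprK//; exact: L2N. Qed.

Lemma nsqD f g : L2 f -> L2 g ->
  nsq (f + g) = nsq f + nsq g + 2 * Re (inner2 f g).
Proof.
move=> f2 g2; rewrite /nsq ipDl ?ipDr//; last exact: L2D.
by rewrite !ReD (ipC f2 g2) Re_conj; ring.
Qed.

Lemma nsqB f g : L2 f -> L2 g ->
  nsq (f - g) = nsq f + nsq g - 2 * Re (inner2 f g).
Proof.
move=> f2 g2; rewrite nsqD//; last exact: L2N.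
by rewrite nsqN// ipNr// ReN mulrN.
Qed.

Lemma CauchySchwarz f g : L2 f -> L2 g ->
  sqn (inner2 f g) <= nsq f * nsq g.
Proof.
move=> f2 g2; set k := inner2 f g.
(* This expands |f - s k g|^2 >= 0 for real s. The best choice s = 1 / |g|^2 gives the claim, and if
   |g| = 0 then g vanishes almost everywhere. *)
have key (s : R) : 0 <= nsq f - 2 * (s * sqn k) + s ^+ 2 * sqn k * nsq g.
  have := nsq_ge0 (f - cst (s%:C * k) * g).
  rewrite nsqB ?nsqZ ?ipZr//; last exact: L2Z.
  rewrite -/k cjM -mulrA (mulrC k^*) mulcJ sqnM.
  have -> : (s%:C)^* = s%:C by exact: conjc_real.
  have -> : sqn s%:C = s ^+ 2 by rewrite /sqn /= expr0n addr0.
  rewrite -rmorphM [Re _]/= => h; apply: (le_trans h).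
  by rewrite le_eqVlt; apply/orP; left; apply/eqP; ring.
have [g0|] := eqVneq (nsq g) 0.
  have /nsq0_eqT := g0 => /(_ g2) gT.
  rewrite /k (ip_ae (eqT_refl f) gT) ip0r /sqn /=.
  by rewrite expr0n/= addr0 g0 mulr0.
move=> g0; have gp : 0 < nsq g by rewrite lt_def g0 nsq_ge0.
have := key (nsq g)^-1.
have -> : nsq f - 2 * ((nsq g)^-1 * sqn k) + (nsq g)^-1 ^+ 2 * sqn k * nsq g =
  nsq f - (nsq g)^-1 * sqn k by field.
by rewrite subr_ge0 mulrC ler_pdivrMr.
Qed.

End SquareIntegrable.

(** * Arc length and exponentials *)

Section ArcLength.
Variable R : realType.
Local Notation C := R[i].
Local Notation P := (circ R).
Local Notation leb := (@lebesgue_measure R).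
Implicit Types (f g h b : C -> C) (c z w : C) (t x : R).

Definition ez (k : int) : C -> C := fun z => z ^ k.

Lemma funX f n z : (f ^+ n) z = f z ^+ n.
Proof. by elim: n => [|n ih]; rewrite ?expr0// !exprS -ih. Qed.

Lemma norm_ez k t : `|ez k (expi t)| = 1.
Proof. by case: k => n; rewrite /ez/= ?normfV normrX norm_expi expr1n ?invr1. Qed.

Lemma cmeas_ez k : cmeas (ez k).
Proof.
case: k => n.
  apply: (cmeas_eq _ (cmeasX n (cmeas_id R))) => t.
  by rewrite funX.
apply: (cmeas_eq _ (cmeas_conj (cmeasX n.+1 (cmeas_id R)))) => t.
by rewrite /conjf funX/= rmorphXn/= conj_expi exprVn.
Qed.

Lemma bdd_ez k : bdd (ez k).
Proof. by apply: bdd_unimodular; [exact: cmeas_ez|exact: norm_ez]. Qed.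

Lemma conj_ez k t : (ez k (expi t))^* = ez (- k) (expi t).
Proof. by rewrite conj_unimodular ?norm_ez// /ez -invr_expz. Qed.

Lemma fcoefE f k : fcoef f k = inner2 f (ez k).
Proof. by apply: cint_on => t; rewrite conj_ez. Qed.

Lemma ezD j k t : ez (j + k) (expi t) = ez j (expi t) * ez k (expi t).
Proof. by rewrite /ez expfzDr ?expi_neq0. Qed.

Lemma expiD s t : expi (s + t) = expi s * expi t.
Proof. by rewrite /expi cosD sinD; congr (_ +i* _); rewrite addrC. Qed.

Lemma expiX t n : expi t ^+ n = expi (n%:R * t).
Proof.
elim: n => [|n ih]; first by rewrite expr0 mul0r /expi cos0 sin0.
by rewrite exprS ih -expiD -natr1 mulrDl mul1r addrC.
Qed.

Lemma ae_circ (A : R -> Prop) : {ae leb, forall t, A t} -> {ae P, forall t, A t}.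
Proof.
move=> [N [mN N0 AN]]; exists N; split => //.
by have /null_content_dominatesP := dominates_uniform_prob (twopi_gt0 R); apply.
Qed.

Lemma ae_neq x : {ae P, forall t, t != x}.
Proof.
apply: ae_circ; exists [set x]; split => //; first exact: lebesgue_measure_set1.
by move=> t /= /negP; rewrite negbK => /eqP.
Qed.

Lemma ae_open_arc : {ae P, forall t, 0 < t < 2 * pi}.
Proof.
have h : {ae P, forall t, 0 <= t <= 2 * pi}.
  exists (~` `[0, 2 * pi]%classic); split.
  - exact: measurableC.
  - rewrite /circ /= /uniform_prob integral_uniform_pdf.
    by rewrite setICl integral_set0.
  - by move=> t /=; rewrite in_itv.
apply: aeS (aeI h (aeI (ae_neq 0) (ae_neq (2 * pi)))) => t [/andP[t0 t1] [n0 n1]].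
by rewrite !lt_def t0 n0 eq_sym n1.
Qed.

Lemma fin_num_pmull (c : R) (y : \bar R) : 0 < c ->
  (c%:E * y)%E \is a fin_num -> y \is a fin_num.
Proof.
move=> c0; case: y => //.
- by rewrite gt0_muley ?lte_fin.
- by rewrite gt0_muleNy ?lte_fin.
Qed.

(** The density formula of the uniform law is applied to nonnegative functions, hence to the
    positive and negative parts apart. Finiteness passes to the Lebesgue integrals because the
    density 1 / (2 pi) is a positive constant. *)
Lemma circ_integral (u : R -> R) :
  P.-integrable setT (fun t => (u t)%:E) ->
  leb.-integrable `[0, 2 * pi] (fun t => (u t)%:E) /\
  \int[P]_t u t = (2 * pi)^-1 * \int[leb]_(t in `[0, 2 * pi]) u t.
Proof.
move=> iu; have /measurable_int mu := iu.
have c0 : 0 < (2 * pi : R)^-1 by rewrite invr_gt0 twopi_gt0.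
have key (v : R -> \bar R) : measurable_fun setT v -> (forall t, 0 <= v t)%E ->
    (\int[P]_t v t = (2 * pi)^-1%:E * \int[leb]_(t in `[0%R, (2 * pi)%R]) v t)%E.
  by move=> mv v0; rewrite integral_uniform// subr0.
have finK (x y : \bar R) : (x = (2 * pi)^-1%:E * y)%E -> (x \is a fin_num)%E ->
    (y \is a fin_num)%E.
  by move=> ->; exact: fin_num_pmull.
have intu : leb.-integrable `[0, 2 * pi] (fun t => (u t)%:E).
  apply/integrableP; split; first exact: measurable_funTS.
  have /integrableP[_ ltu] := iu.
  rewrite ltey_eq; apply/orP; left; apply: finK.
    by apply: (key (fun t => `|(u t)%:E|)%E) => //; exact: measurableT_comp.
  by rewrite ge0_fin_numE// integral_ge0.
split=> //; rewrite /Rintegral.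
rewrite integralE [in RHS]integralE.
have kp := key _ (measurable_funepos mu) (fun t => funepos_ge0 _ _).
have kn := key _ (measurable_funeneg mu) (fun t => funeneg_ge0 _ _).
have fp := integrable_pos_fin_num measurableT iu.
have fn := integrable_neg_fin_num measurableT iu.
have gp := finK _ _ kp fp; have gn := finK _ _ kn fn.
rewrite (fineB fp fn) (fineB gp gn) kp kn (fineM _ gp)// (fineM _ gn)//.
by rewrite /= mulrBr.
Qed.

End ArcLength.

(** * Orthonormality of the exponentials *)

Section OrthonormalExponentials.
Variable R : realType.
Local Notation C := R[i].
Local Notation P := (circ R).
Implicit Types (f g h b : C -> C) (c z w : C) (t x : R).

Lemma circ_integral_derivative (F f : R -> R) (M : R) :
  (forall t, is_derive t 1 F (f t)) -> continuous f ->
  (forall t, `|f t| <= M) -> F (2 * pi) = F 0 -> \int[P]_t f t = 0.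
Proof.
move=> dF cf fM Fper.
have mf : measurable_fun [set: measurableTypeR R] f.
  exact: continuous_measurable_fun.
have intf : P.-integrable setT (fun t => (f t)%:E).
  apply: (@le_integrable _ _ _ _ _ measurableT _ (fun=> M%:E)).
  - exact/measurable_EFinP.
  - by move=> t _ /=; rewrite lee_fin (le_trans (fM t))// ler_norm.
  - exact: finite_measure_integrable_cst.
have [_ ->] := circ_integral intf.
rewrite /Rintegral (@continuous_FTC2 _ _ F); first by rewrite -EFinB Fper subrr mulr0.
- exact: twopi_gt0.
- exact: continuous_subspaceT.
- have cF : continuous F.
    move=> t; apply: differentiable_continuous.
    by apply/derivable1_diffP; have [] := dF t.
  split.
  + by move=> t _; have [] := dF t.
  + by apply: cvg_at_right_filter; exact: cF.
  + by apply: cvg_at_left_filter; exact: cF.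
- by move=> t _; rewrite derive1E; have [_ ->] := dF t.
Qed.

Lemma is_derive_lin (c t : R) : is_derive t 1 (fun s : R => c * s) c.
Proof. by apply: is_derive_eq; rewrite /GRing.scale/= mulr1. Qed.

Lemma is_derive_sin_lin (a c t : R) :
  is_derive t 1 (fun s : R => a * sin (c * s)) (a * (cos (c * t) * c)).
Proof.
apply: (@is_deriveZ _ _ _ (fun s => sin (c * s)) a).
exact: (is_derive1_comp (is_derive_sin (c * t)) (is_derive_lin c t)).
Qed.

Lemma is_derive_cos_lin (a c t : R) :
  is_derive t 1 (fun s : R => a * cos (c * s)) (a * (- sin (c * t) * c)).
Proof.
apply: (@is_deriveZ _ _ _ (fun s => cos (c * s)) a).
exact: (is_derive1_comp (is_derive_cos (c * t)) (is_derive_lin c t)).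
Qed.

Lemma expi_period n t : expi (n%:R * (2 * pi + t)) = expi (n%:R * t) :> C.
Proof.
rewrite -!expiX expiD; congr (_ ^+ n).
have -> : 2 * pi = (0 : R) + pi *+ 2 by ring.
by rewrite /expi cosD2pi sinD2pi cos0 sin0 mul1r.
Qed.

(** For k > 0 both parts of the integrand are derivatives of functions with equal values at 0 and 2
    pi; negative indices follow by conjugation. *)
Lemma cint_ez k : cint (ez k : C -> C) = (k == 0)%:R.
Proof.
have pos n : cint (ez n.+1 : C -> C) = 0.
  set c : R := n.+1%:R.
  have n0 : c != 0 :> R by rewrite pnatr_eq0.
  have per : expi (c * (2 * pi)) = expi (c * 0) :> C.
    by rewrite -(expi_period n.+1 0) addr0.
  case: per => perc pers.
  have cc : continuous (fun s : R => c * s).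
    by move=> s; apply: cvgM; [exact: cvg_cst|exact: cvg_id].
  rewrite /cint.
  under eq_Rintegral do rewrite /ez -exprnP expiX/=.
  under [X in _ +i* X]eq_Rintegral do rewrite /ez -exprnP expiX/=.
  congr (_ +i* _).
  - apply: (@circ_integral_derivative (fun t => c^-1 * sin (c * t))
      (fun t => cos (c * t)) 1).
    + by move=> t; have := is_derive_sin_lin c^-1 c t; rewrite mulrCA mulVf// mulr1.
    + by move=> t; apply: continuous_comp; [exact: cc|exact: continuous_cos].
    + by move=> t; exact: cos_max.
    + by rewrite pers.
  - apply: (@circ_integral_derivative (fun t => - c^-1 * cos (c * t))
      (fun t => sin (c * t)) 1).
    + move=> t; have := is_derive_cos_lin (- c^-1) c t.
      by rewrite (_ : - c^-1 * (- sin (c * t) * c) = sin (c * t)); last by field.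
    + by move=> t; apply: continuous_comp; [exact: cc|exact: continuous_sin].
    + by move=> t; exact: sin_max.
    + by rewrite perc.
case: k => [[|n]|n].
- rewrite (cint_on (g := cst 1)) ?eqxx; last by move=> t; rewrite /ez expr0z.
  have -> : cst 1 = (ez 0 : C -> C) * conjf (ez 0).
    by apply/funext => z; rewrite /conjf !fctE /ez expr0z cj1 mulr1.
  rewrite -ipE ip_self; last exact/bdd_L2/bdd_ez.
  rewrite nsqE (_ : (fun t => _) = fun=> 1); last first.
    by apply/funext => t; rewrite sqn_unimodular// norm_ez.
  by rewrite Rintegral_cst//= mul1r (@probability_setT _ _ _ P).
- exact: pos.
- have -> : Negz n == 0 = false by [].
  rewrite -[RHS]cj0 -(pos n) -cint_conj; last exact/L2_L1/bdd_L2/bdd_ez.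
  by apply: cint_on => t; rewrite /conjf conj_ez NegzE.
Qed.

Lemma ip_ez j k : inner2 (ez j : C -> C) (ez k) = (j == k)%:R.
Proof.
rewrite -[j == k]subr_eq0 -cint_ez; apply: cint_on => t.
by rewrite conj_ez ezD.
Qed.

End OrthonormalExponentials.

(** * Uniqueness of Fourier coefficients *)

Section PeakFunctions.
Variable R : realType.
Local Notation C := R[i].
Local Notation P := (circ R).
Local Notation leb := (@lebesgue_measure R).
Implicit Types (f g h b T : C -> C) (c z w : C) (t x r : R).

(* As n grows, [peak n r] tends to 1 for 0 <= r < 1/2 and to 0 for
   1/2 < r <= 1, by Bernoulli's inequality. Composed with [bump x], a
   trigonometric polynomial of degree 1 in t, it approximates the indicator
   function of ]0, x[ boundedly. *)
Definition peak n r : R := (1 - r ^+ n) ^+ (2 ^ n).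

Lemma peak01 n r : 0 <= r <= 1 -> 0 <= peak n r <= 1.
Proof.
move=> /andP[r0 r1]; rewrite /peak exprn_ge0 ?exprn_ile1//=.
- by rewrite subr_ge0 exprn_ile1.
- by rewrite lerBlDr lerDl exprn_ge0.
- by rewrite subr_ge0 exprn_ile1.
Qed.

Lemma bernoulli_le (y : R) n : 0 <= y <= 1 -> 1 - n%:R * y <= (1 - y) ^+ n.
Proof.
move=> /andP[y0 y1]; elim: n => [|n ih]; first by rewrite mul0r subr0 expr0.
rewrite exprS; apply: (@le_trans _ _ ((1 - y) * (1 - n%:R * y))).
  have : 0 <= n%:R * y ^+ 2 by rewrite mulr_ge0 ?sqr_ge0 ?ler0n.
  by rewrite -natr1; lra.
by rewrite ler_wpM2l// subr_ge0.
Qed.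

Lemma bernoulli_ge (y : R) n : 0 <= y -> 1 + n%:R * y <= (1 + y) ^+ n.
Proof.
move=> y0; elim: n => [|n ih]; first by rewrite mul0r addr0 expr0.
rewrite exprS; apply: (@le_trans _ _ ((1 + y) * (1 + n%:R * y))).
  have : 0 <= n%:R * y ^+ 2 by rewrite mulr_ge0 ?sqr_ge0 ?ler0n.
  by rewrite -natr1; lra.
by rewrite ler_wpM2l// addr_ge0.
Qed.

Lemma peak_cvg1 r : 0 <= r -> 2 * r < 1 -> peak n r @[n --> \oo] --> (1 : R).
Proof.
move=> r0 r1; apply: (@squeeze_cvgr _ _ _ _ (fun n => 1 - (2 * r) ^+ n) (cst 1)).
- apply: nearW => n; have rn : 0 <= r ^+ n <= 1.
    by rewrite exprn_ge0// exprn_ile1//; lra.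
  apply/andP; split; last first.
    by have /andP[] : 0 <= peak n r <= 1 by apply: peak01; lra.
  rewrite exprMn; apply: le_trans (bernoulli_le (2 ^ n) rn).
  by rewrite natrX.
- rewrite -[X in _ --> X]subr0; apply: cvgB; first exact: cvg_cst.
  by apply: cvg_expr; rewrite ger0_norm ?mulr_ge0.
- exact: cvg_cst.
Qed.

Lemma peak_cvg0 r : r <= 1 -> 1 < 2 * r -> peak n r @[n --> \oo] --> (0 : R).
Proof.
move=> r1 r2; have r0 : 0 <= r by lra.
apply: (@squeeze_cvgr _ _ _ _ (cst 0) (fun n => (2 * r)^-1 ^+ n)).
- apply: nearW => n; have /andP[p0 p1] : 0 <= peak n r <= 1 by apply: peak01; lra.
  rewrite p0/=.
  have rn : 0 <= r ^+ n <= 1 by rewrite exprn_ge0// exprn_ile1.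
  have y0 : 0 < (2 * r) ^+ n by rewrite exprn_gt0//; lra.
  rewrite exprVn -[leRHS]mul1r ler_pdivlMr//.
  (* Since (1 - r^n) (1 + r^n) <= 1, the peak is at most the inverse of (1 + r^n)^(2^n), and
     Bernoulli bounds that power below by (2 r)^n. *)
  apply: (@le_trans _ _ (peak n r * (1 + r ^+ n) ^+ (2 ^ n))).
    rewrite ler_wpM2l//; have /andP[rn0 _] := rn.
    by have := bernoulli_ge (2 ^ n) rn0; rewrite natrX exprMn; lra.
  rewrite /peak -exprMn exprn_ile1//; nra.
- exact: cvg_cst.
- by apply: cvg_expr; rewrite ger0_norm ?invr_ge0 ?invf_lt1//; lra.
Qed.

(** For t in ]0, 2 pi[, the cosine of t - x/2 exceeds that of x/2 exactly when t < x, so the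
    threshold 1/2 separates the arc from its complement. The factor 1/4 keeps the values in
    [0, 1]. *)
Definition bump x t : R := 1 / 2 - (cos (t - x / 2) - cos (x / 2)) / 4.

Lemma bump01 x t : 0 <= bump x t <= 1.
Proof.
rewrite /bump; have := cos_le1 (t - x / 2); have := cos_geN1 (t - x / 2).
have := cos_le1 (x / 2); have := cos_geN1 (x / 2).
by set a := cos _; set b := cos _; lra.
Qed.

Lemma bump_lt x t : 0 < x < 2 * pi -> 0 < t < 2 * pi -> t < x -> 2 * bump x t < 1.
Proof.
move=> hx ht tx.
(* In product form the sign is visible: both half angles lie in ]0, pi[. *)
have e : cos (t - x / 2) - cos (x / 2) = 2 * (sin (t / 2) * sin ((x - t) / 2)).
  have -> : t - x / 2 = t / 2 - (x - t) / 2 by lra.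
  have -> : x / 2 = t / 2 + (x - t) / 2 by lra.
  by rewrite cosB cosD; ring.
rewrite /bump e.
have s1 : 0 < sin (t / 2) by apply: sin_gt0_pi; lra.
have s2 : 0 < sin ((x - t) / 2) by apply: sin_gt0_pi; lra.
have := mulr_gt0 s1 s2; lra.
Qed.

Lemma bump_gt x t : 0 < x < 2 * pi -> 0 < t < 2 * pi -> x < t -> 1 < 2 * bump x t.
Proof.
move=> hx ht tx.
have e : cos (t - x / 2) - cos (x / 2) = - (2 * (sin (t / 2) * sin ((t - x) / 2))).
  have -> : t - x / 2 = t / 2 + (t - x) / 2 by lra.
  have -> : x / 2 = t / 2 - (t - x) / 2 by lra.
  by rewrite cosB cosD; ring.
rewrite /bump e.
have s1 : 0 < sin (t / 2) by apply: sin_gt0_pi; lra.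
have s2 : 0 < sin ((t - x) / 2) by apply: sin_gt0_pi; lra.
have := mulr_gt0 s1 s2; lra.
Qed.

Lemma measurable_bump x : measurable_fun [set: measurableTypeR R] (bump x).
Proof.
rewrite /bump; apply: measurable_funB => //; apply: measurable_funM => //.
apply: measurable_funB => //.
apply: (@measurableT_comp _ _ _ _ _ _ cos) => //.
  by apply: continuous_measurable_fun; exact: continuous_cos.
exact: measurable_funB.
Qed.

Lemma peak_bump_cvg x : 0 < x < 2 * pi ->
  {ae P, forall t, peak n (bump x t) @[n --> \oo] --> ((t < x)%R%:R : R)}.
Proof.
move=> hx; apply: aeS (aeI (ae_open_arc R) (ae_neq x)) => t [ht /negP tx].
have /andP[b0 b1] := bump01 x t.
case: (ltrgtP t x) => [tx'|xt|e].
- exact: (peak_cvg1 b0 (bump_lt hx ht tx')).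
- exact: (peak_cvg0 b1 (bump_gt hx ht xt)).
- by case: tx; rewrite e.
Qed.

Lemma arc_integral_eq0 (v : R -> R) x : 0 < x < 2 * pi ->
  P.-integrable setT (fun t => (v t)%:E) ->
  (forall n, \int[P]_t (v t * peak n (bump x t)) = 0) ->
  \int[P]_t (v t * (t < x)%R%:R) = 0.
Proof.
move=> hx iv v0; have /measurable_int/measurable_EFinP mv := iv.
have mb := measurable_bump x.
have mlt : measurable_fun [set: measurableTypeR R] (fun t : R => (t < x)%R%:R : R).
  rewrite (_ : (fun t : R => _) = \1_(`]-oo, x[%classic)).
    exact: measurable_indic.
  by apply/funext => t; rewrite indicE mem_setE in_itv.
have [|||||_ cv] := @Rintegral_dominated _ (fun n t => v t * peak n (bump x t))
  (fun t => v t * (t < x)%R%:R) (fun t => `|v t|).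
- move=> n; apply: measurable_funM => //; apply: measurable_funX.
  by apply: measurable_funB => //; exact: measurable_funX.
- exact: measurable_funM.
- by apply: aeS (peak_bump_cvg hx) => t ct; apply: cvgM => //; exact: cvg_cst.
- exact: integrable_norm.
- apply: aeW => t n; rewrite normrM ler_piMr//.
  by have /andP[p0 p1] := peak01 n (bump01 x t); rewrite ger0_norm.
rewrite -(cvg_lim _ cv)//.
by under eq_fun do rewrite v0; rewrite lim_cst.
Qed.

(** The peaks make the integral of [v] vanish over every arc ]0, x[. The primitive of [v], extended
    by 0 outside [0, 2 pi], is therefore constant, and Lebesgue differentiation gives v = 0 almost
    everywhere. *)
Lemma integral_peak_eq0 (v : R -> R) :
  P.-integrable setT (fun t => (v t)%:E) -> \int[P]_t v t = 0 ->
  (forall x n, 0 < x < 2 * pi -> \int[P]_t (v t * peak n (bump x t)) = 0) ->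
  {ae P, forall t, v t = 0}.
Proof.
move=> iv v0 vp; have /measurable_int/measurable_EFinP mv := iv.
have mlt x : measurable_fun [set: measurableTypeR R] (fun t : R => (t < x)%R%:R : R).
  rewrite (_ : (fun t : R => _) = \1_(`]-oo, x[%classic)).
    exact: measurable_indic.
  by apply/funext => t; rewrite indicE mem_setE in_itv.
have iw x : P.-integrable setT (fun t => (v t * (t < x)%R%:R)%:E).
  apply: le_integrable iv => //.
  - by apply/measurable_EFinP; exact: measurable_funM.
  - by move=> t _; rewrite lee_fin normrM ler_piMr//; case: (t < x); rewrite ?normr1 ?normr0.
have w0 x : \int[P]_t (v t * (t < x)%R%:R) = 0.
  have [x0|x0] := leP x 0.
    rewrite /Rintegral (ae_eq_integralT (g := cst 0%E)) ?integral0//.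
    apply: aeS (ae_open_arc R) => t /andP[t0 _].
    by rewrite ltNge (le_trans x0 (ltW t0)) mulr0.
  have [x1|x1] := leP (2 * pi) x.
    rewrite -v0 /Rintegral; congr fine; apply: ae_eq_integralT.
    apply: aeS (ae_open_arc R) => t /andP[_ t0].
    by rewrite (lt_le_trans t0 x1) mulr1.
  by apply: arc_integral_eq0; rewrite ?x0// => n; apply: vp; rewrite x0.
pose f1 : R -> R := v \_ `[0, 2 * pi].
have [iv' _] := circ_integral iv.
have if1 : leb.-integrable setT (EFin \o f1).
  by rewrite /f1 -restrict_EFin; apply/integrable_restrict => //; rewrite setTI.
have F0 x : \int[leb]_(t in `]-oo, x]) f1 t = 0.
  have [_ e] := circ_integral (iw x).
  have : \int[leb]_(t in `[0, 2 * pi]) (v t * (t < x)%R%:R) = 0.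
    apply/eqP; have := esym e; rewrite w0 => /eqP.
    by rewrite mulf_eq0 invr_eq0 gt_eqF ?twopi_gt0.
  move=> <-; rewrite -Rintegral_itv_bndo_bndc; last exact: integrableS if1.
  rewrite Rintegral_mkcond [RHS]Rintegral_mkcond; apply: eq_Rintegral => t _.
  rewrite !patchE /f1 patchE !mem_setE !in_itv/=.
  by case: (t < x); rewrite ?mulr1 ?mulr0//; case: ifP.
have := @FTC1Ny R f1.
have -> : (fun x => \int[leb]_(t in [set` `]-oo, x]]) f1 t) = cst 0.
  by apply/funext => x; exact: F0.
move=> /(_ _ _) H.
have lif : locally_integrable setT f1.
  split.
  - by have /measurable_int/measurable_EFinP := if1.
  - exact: openT.
  - move=> K _ cK; have mK : measurable (K : set (measurableTypeR R)) by exact: compact_measurable.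
    by have /integrableP[] := integrableS measurableT mK (@subsetT _ _) if1.
have : {ae leb, forall x, f1 x = 0}.
  have iK y : leb.-integrable (`]-oo, y]%classic : set (measurableTypeR R)) (EFin \o f1).
    by apply: integrableS if1 => //; exact: measurable_itv.
  have := H iK lif.
  apply: aeS => t [_ <-].
  by rewrite derive1_cst.
move=> /ae_circ => h; apply: aeS (aeI h (ae_open_arc R)) => t [+ /andP[t0 t1]].
by rewrite /f1 patchE mem_setE in_itv/= !ltW.
Qed.

End PeakFunctions.

Section FourierUniqueness.
Variable R : realType.
Local Notation C := R[i].
Local Notation P := (circ R).
Local Notation Re := complex.Re.
Local Notation Im := complex.Im.
Implicit Types (f g h b T : C -> C) (c z w : C) (t x r : R).

(* The bounded T for which f T has no Fourier coefficient form an algebra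
   containing the trigonometric polynomials if f has none. *)
Definition annihilates f T : Prop :=
  bdd T /\ forall k, cint (f * (ez k * T)) = 0.

Section Annihilates.
Variables (f : C -> C) (f2 : L2 f).

Let L1f T k : bdd T -> L1 (f * (ez k * T)).
Proof. by move=> bT; apply: L2_mulL1 => //; apply/bdd_L2/bddM => //; exact: bdd_ez. Qed.

Lemma annihilatesD S T :
  annihilates f S -> annihilates f T -> annihilates f (S + T).
Proof.
move=> [bS S0] [bT T0]; split; first exact: bddD.
by move=> k; rewrite 2!mulrDr cintD ?S0 ?T0 ?addr0//; exact: L1f.
Qed.

Lemma annihilatesZ c T : annihilates f T -> annihilates f (cst c * T).
Proof.
move=> [bT T0]; split; first by apply: bddM => //; exact: bdd_cst.
move=> k; rewrite (_ : f * _ = cst c * (f * (ez k * T))); last by ring.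
by rewrite cintZ ?T0 ?mulr0//; exact: L1f.
Qed.

Lemma annihilates_ez j T : annihilates f T -> annihilates f (ez j * T).
Proof.
move=> [bT T0]; split; first by apply: bddM => //; exact: bdd_ez.
move=> k; rewrite -[RHS](T0 (k + j)); apply: cint_on => t.
by rewrite !fctE ezD !mulrA.
Qed.

Lemma annihilatesB S T :
  annihilates f S -> annihilates f T -> annihilates f (S - T).
Proof.
move=> fS fT; rewrite (_ : S - T = S + cst (-1) * T); last first.
  by apply/funext => z; rewrite !fctE mulN1r.
by apply: annihilatesD => //; exact: annihilatesZ.
Qed.

(** [bump x] as a trigonometric polynomial: the coefficients 1/8 are 1/4 times the 1/2 in cos s =
    (e^(i s) + e^(- i s)) / 2, with s = t - x/2. *)
Definition bumpf x : C -> C :=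
  cst (1 / 2 + cos (x / 2) / 4)%:C + cst (- 8^-1%:C * expi (- (x / 2))) * ez 1 +
  cst (- 8^-1%:C * expi (x / 2)) * ez (-1).

Lemma bumpfE x t : bumpf x (expi t) = (bump x t)%:C.
Proof.
rewrite /bumpf !fctE -!mulrA /ez expr1z exprN1 -conj_expi -/expi.
have -> : (expi t)^* = expi (- t) :> C by rewrite /expi cosN sinN.
rewrite -!expiD /bump (addrC (- (x / 2))) (addrC (x / 2)).
rewrite (_ : - t + x / 2 = - (t - x / 2)); last by ring.
rewrite /expi cosN sinN; apply/eqP; rewrite eq_complex/=.
by apply/andP; split; apply/eqP; field.
Qed.

Lemma annihilates_bump x T : annihilates f T -> annihilates f (bumpf x * T).
Proof.
move=> fT; rewrite /bumpf 2!mulrDl -(mulrA (cst _) (ez 1)) -(mulrA (cst _) (ez (-1))).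
by apply: annihilatesD; [apply: annihilatesD|]; apply: annihilatesZ => //;
  exact: annihilates_ez.
Qed.

Lemma annihilates_bumpX x n T : annihilates f T -> annihilates f (bumpf x ^+ n * T).
Proof.
move=> fT; elim: n => [|n ih]; first by rewrite expr0 mul1r.
by rewrite exprS -mulrA; exact: annihilates_bump.
Qed.

Lemma annihilates_peak x n : annihilates f 1 ->
  annihilates f ((1 - bumpf x ^+ n) ^+ (2 ^ n)).
Proof.
move=> f1; elim: (2 ^ n)%N => [|m ih]; first by rewrite expr0.
rewrite exprS mulrBl mul1r; apply: annihilatesB => //.
exact: annihilates_bumpX.
Qed.

End Annihilates.

(** Every peak is a trigonometric polynomial on the circle, so [f] integrates to zero against it.
    Peaks are real there, so this splits into the real and imaginary parts of [f], to which the real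
    statement applies. *)
Theorem fcoef_eq0 f : L2 f -> (forall k, fcoef f k = 0) -> eqT f 0.
Proof.
move=> f2 f0.
have ann1 : annihilates f 1.
  split=> [|k]; first exact: (bdd_cst 1).
  by rewrite mulr1 -[RHS](f0 (- k)) fcoefE ipE; apply: cint_on => t;
    rewrite !fctE /conjf conj_ez opprK.
have [fr fi] := L2_L1 f2.
have cf0 : cint f = 0.
  by rewrite -[RHS](ann1.2 0) mulr1; apply: cint_on => t; rewrite !fctE /ez expr0z mulr1.
have pk x n : cint (f * (1 - bumpf x ^+ n) ^+ (2 ^ n)) = 0.
  rewrite -[RHS]((annihilates_peak f2 x n ann1).2 0).
  by apply: cint_on => t; rewrite !fctE /ez expr0z mul1r.
have pkE x n t : (f * (1 - bumpf x ^+ n) ^+ (2 ^ n)) (expi t) =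
    f (expi t) * (peak n (bump x t))%:C.
  have -> : (peak n (bump x t))%:C = (1 - (bump x t)%:C ^+ n) ^+ (2 ^ n).
    by rewrite /peak rmorphXn/= rmorphB/= rmorph1 rmorphXn.
  rewrite -bumpfE -(funX (bumpf x)).
  transitivity (f (expi t) * ((1 - bumpf x ^+ n) (expi t)) ^+ (2 ^ n)) => //.
  by rewrite -funX.
have zr : {ae P, forall t, Re (f (expi t)) = 0}.
  apply: integral_peak_eq0 => //; first by move: cf0 => [].
  move=> x n _; rewrite -[RHS](congr1 (@complex.Re R) (pk x n)); apply: eq_Rintegral => t _.
  by rewrite pkE ReM/= mulr0 subr0.
have zi : {ae P, forall t, Im (f (expi t)) = 0}.
  apply: integral_peak_eq0 => //; first by move: cf0 => [].
  move=> x n _; rewrite -[RHS](congr1 (@complex.Im R) (pk x n)); apply: eq_Rintegral => t _.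
  by rewrite pkE ImM/= mulr0 add0r mulrC.
apply: aeS (aeI zr zi) => t [r i]; apply/eqP.
by rewrite eq_complex r i !eqxx.
Qed.

End FourierUniqueness.

(** * Completeness of L^2 *)

Section RieszFischer.
Variable R : realType.
Local Notation C := R[i].
Local Notation P := (circ R).
Local Notation Re := complex.Re.
Local Notation Im := complex.Im.
Implicit Types (f g h b : C -> C) (c z w : C) (t x r : R).

(** Iterating [sqnD_le] doubles the weight at each summand. Weights 2^k are affordable below, where
    the squared norms of the increments decay like 4^-k. *)
Lemma sqn_sum_le (a : nat -> C) m :
  sqn (\sum_(k < m) a k) <= 2 * \sum_(k < m) 2 ^+ k * sqn (a k).
Proof.
elim: m a => [|m ih] a; first by rewrite !big_ord0 mulr0 /sqn /= expr0n addr0.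
rewrite !big_ord_recl expr0 mul1r; apply: le_trans (sqnD_le _ _) _.
rewrite ler_pM2l// lerD2l; apply: le_trans (ih (fun k => a k.+1)) _.
rewrite mulr_sumr le_eqVlt; apply/orP; left; apply/eqP.
by apply: eq_bigr => k _; rewrite mulrA -exprS.
Qed.

Lemma cvg_sqr_dist (x : nat -> R) (c : R) :
  (forall n m, (x (n + m)%N - x n) ^+ 2 <= c * 2^-1 ^+ n) -> cvgn x.
Proof.
move=> xc; apply: cauchy_cvg; apply: cauchy_exP => e e0.
have cv : c * 2^-1 ^+ n @[n --> \oo] --> (0 : R).
  rewrite -(mulr0 c); apply: cvgM; first exact: cvg_cst.
  by apply: cvg_expr; rewrite ger0_norm; lra.
have e2 : 0 < e ^+ 2 by rewrite exprn_gt0.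
have /cvgrPdist_lt/(_ _ e2) [N _ HN] := cv.
exists (x N); exists N => // n /= Nn.
have := HN N (leqnn N); rewrite /= sub0r normrN => hN.
have := xc N (n - N)%N; rewrite subnKC// => h.
rewrite /ball/= distrC -(ltr_pXn2r (n := 2)) ?nnegrE ?normr_ge0 ?(ltW e0)//.
rewrite real_normK ?num_real//.
by apply: le_lt_trans h (le_lt_trans (ler_norm _) hN).
Qed.

Section FastCauchy.
Variables (u : nat -> C -> C) (u2 : forall n, L2 (u n)).
Hypothesis du : forall n, nsq (u n.+1 - u n) <= 4^-1 ^+ n.

Let d n : C -> C := u n.+1 - u n.
(** A single majorant for all increments: where it is finite the sequence is Cauchy at rate 2^-n,
    and its integral is at most the sum of 2^k 4^-k, which is 2. *)
Let G z : \bar R := (\sum_(0 <= k <oo) (2 ^+ k * sqn (d k z))%:E)%E.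

Let d2 n : L2 (d n). Proof. exact: L2B. Qed.

Let term_ge0 k z : 0 <= 2 ^+ k * sqn (d k z).
Proof. by rewrite mulr_ge0 ?sqn_ge0. Qed.

(** The weight of the increment of index n + k is 2^n times the weight 2^k used by [sqn_sum_le];
    this surplus is the factor 2^-n. *)
Let sum_le n m z : sqn (u (n + m)%N z - u n z) <=
  2 * 2^-1 ^+ n * \sum_(k < n + m) 2 ^+ k * sqn (d k z).
Proof.
have -> : u (n + m)%N z - u n z = \sum_(k < m) d (n + k)%N z.
  elim: m => [|m ih]; first by rewrite big_ord0 addn0 subrr.
  by rewrite big_ord_recr/= -ih addnS /d !fctE; ring.
apply: le_trans (sqn_sum_le (fun k => d (n + k)%N z) m) _; rewrite -mulrA ler_pM2l// mulr_sumr.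
rewrite big_split_ord/= [leRHS]addrC.
have -> : \sum_(i < m) 2^-1 ^+ n * (2 ^+ (n + i) * sqn (d (n + i) z)) =
  \sum_(k < m) 2 ^+ k * sqn (d (n + k) z).
  apply: eq_bigr => k _; rewrite exprD !mulrA -exprMn mulVf ?expr1n ?mul1r//.
by rewrite lerDl sumr_ge0// => k _; rewrite mulr_ge0 ?exprn_ge0.
Qed.

Let partial_le z N : (G z < +oo)%E ->
  \sum_(k < N) 2 ^+ k * sqn (d k z) <= fine (G z).
Proof.
move=> Goo; rewrite -lee_fin fineK; last first.
  by rewrite ge0_fin_numE//; apply: nneseries_ge0 => k _ _; rewrite lee_fin.
rewrite -sumEFin; have := @nneseries_lim_ge R (fun k => (2 ^+ k * sqn (d k z))%:E) xpredT 0%N N.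
by rewrite big_mkord; apply => k _ _; rewrite lee_fin.
Qed.

Let dist_le n m z : (G z < +oo)%E ->
  sqn (u (n + m)%N z - u n z) <= 2 * fine (G z) * 2^-1 ^+ n.
Proof.
move=> Goo; apply: le_trans (sum_le n m z) _.
rewrite [leRHS]mulrAC ler_wpM2l//; last exact: partial_le.
Qed.

Let f z : C := if (G z < +oo)%E
  then limn (fun n => Re (u n z)) +i* limn (fun n => Im (u n z)) else 0.

Let cvg_u z : (G z < +oo)%E ->
  Re (u n z) @[n --> \oo] --> Re (f z) /\ Im (u n z) @[n --> \oo] --> Im (f z).
Proof.
move=> Goo; rewrite /f Goo/=; split.
- apply: (@cvg_sqr_dist _ (2 * fine (G z))) => n m.
  apply: le_trans (dist_le n m Goo); rewrite /sqn ReD ReN.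
  by rewrite lerDl sqr_ge0.
- apply: (@cvg_sqr_dist _ (2 * fine (G z))) => n m.
  apply: le_trans (dist_le n m Goo); rewrite /sqn ImD ImN.
  by rewrite lerDr sqr_ge0.
Qed.

Let mG : measurable_fun [set: measurableTypeR R] (fun t => G (expi t)).
Proof.
apply: (@ge0_emeasurable_sum _ _ _ _ (fun k t => (2 ^+ k * sqn (d k (expi t)))%:E) xpredT).
- by move=> k t _ _; rewrite lee_fin.
- move=> k _; apply/measurable_EFinP; apply: measurable_funM => //.
  by have /L2_cmeas/cmeas_sqn := d2 k.
Qed.

Let G_ge0 z : (0 <= G z)%E.
Proof. by apply: nneseries_ge0 => k _ _; rewrite lee_fin. Qed.

Let intG_le : (\int[P]_t G (expi t) <= 2%:E)%E.
Proof.
have md k : measurable_fun [set: measurableTypeR R]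
    (fun t => (2 ^+ k * sqn (d k (expi t)))%:E).
  apply/measurable_EFinP; apply: measurable_funM => //.
  by have /L2_cmeas/cmeas_sqn := d2 k.
rewrite integral_nneseries//; last by move=> k t _; rewrite lee_fin.
apply: lime_le.
  apply: is_cvg_nneseries => k _ _.
  by apply: integral_ge0 => t _; rewrite lee_fin.
apply: nearW => n; apply: (@le_trans _ _ (\sum_(0 <= k < n) (1 * 2^-1 ^+ k)%:E)%E).
  apply: lee_sum => k _; have /L2P[mk ik] := d2 k.
  under eq_integral do rewrite EFinM.
  rewrite integralZl// -[X in (_ * X)%E]fineK; last exact: integrable_fin_num.
  rewrite -EFinM lee_fin -/(Rintegral _ _ _) -nsqE mul1r.
  apply: le_trans (ler_wpM2l _ (du k)) _; first exact: exprn_ge0.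
  by rewrite -exprMn le_eqVlt; apply/orP; left; apply/eqP; congr (_ ^+ _); field.
rewrite sumEFin lee_fin.
rewrite [leRHS](_ : 2 = 1 / (1 - 2^-1)); last by field.
by apply: (@geometric_le_lim _ n 1 2^-1) => //; rewrite ?ger0_norm; lra.
Qed.

Let mf : cmeas f.
Proof.
have mb : measurable_fun [set: measurableTypeR R] (fun t => (G (expi t) < +oo)%E).
  by apply: measurable_fun_lte.
split.
- apply: (@measurable_fun_cvg _ _ _ _
    (fun n t => if (G (expi t) < +oo)%E then Re (u n (expi t)) else 0)).
    move=> n; apply: measurable_fun_ifT => //.
    by have [] := L2_cmeas (u2 n).
  move=> t _; have [Goo|Goo] := boolP (G (expi t) < +oo)%E.
    by have [] := cvg_u Goo.
  by rewrite /f (negbTE Goo)/=; exact: cvg_cst.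
- apply: (@measurable_fun_cvg _ _ _ _
    (fun n t => if (G (expi t) < +oo)%E then Im (u n (expi t)) else 0)).
    move=> n; apply: measurable_fun_ifT => //.
    by have [] := L2_cmeas (u2 n).
  move=> t _; have [Goo|Goo] := boolP (G (expi t) < +oo)%E.
    by have [] := cvg_u Goo.
  by rewrite /f (negbTE Goo)/=; exact: cvg_cst.
Qed.

Let lim_le n z : (G z < +oo)%E -> sqn (f z - u n z) <= 2 * fine (G z) * 2^-1 ^+ n.
Proof.
move=> Goo; have [] := cvg_u Goo; rewrite -(cvg_shiftn n) => cr.
rewrite -(cvg_shiftn n) => ci.
have : sqn (u (m + n)%N z - u n z) @[m --> \oo] --> sqn (f z - u n z).
  rewrite /sqn; under eq_fun do rewrite ReD ImD ReN ImN.
  rewrite ReD ImD ReN ImN; apply: cvgD; rewrite expr2; apply: cvgM;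
    apply: cvgB; (try exact: cvg_cst) => //.
move=> cv; rewrite -(cvg_lim _ cv)//; apply: limr_le; first exact: cvgP cv.
by apply: nearW => m; rewrite addnC; exact: dist_le.
Qed.

Let mfB n : cmeas (f - u n).
Proof. exact: cmeasD mf (L2_cmeas (L2N (u2 n))). Qed.

Let int_lim_le n :
  (\int[P]_t (sqn ((f - u n) (expi t)))%:E <= (2 * 2^-1 ^+ n * 2)%:E)%E.
Proof.
have c0 : 0 < 2 * 2^-1 ^+ n :> R by rewrite mulr_gt0 ?exprn_gt0.
apply: (@le_trans _ _ (\int[P]_t ((2 * 2^-1 ^+ n)%:E * G (expi t)))%E); last first.
  rewrite ge0_integralZl ?lee_fin ?(ltW c0)//.
  by rewrite [leRHS]EFinM lee_pmul2l// lte_fin.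
apply: ge0_le_integral => //.
- by move=> t _; rewrite lee_fin sqn_ge0.
- by apply/measurable_EFinP; exact: cmeas_sqn (mfB n).
- exact: measurable_funeM.
(* Where [G] is infinite the right-hand side is infinite too, whatever the default value of [f]
   there. *)
- move=> t _; have [Goo|] := boolP (G (expi t) < +oo)%E; last first.
    by rewrite -leNgt leye_eq => /eqP ->; rewrite gt0_muley ?leey// lte_fin.
  rewrite -[G _]fineK ?ge0_fin_numE// -EFinM lee_fin mulrAC.
  exact: lim_le.
Qed.

Lemma fast_cauchy_cvg : exists2 f, L2 f & nsq (u n - f) @[n --> \oo] --> (0 : R).
Proof.
have fd n : L2 (f - u n).
  apply/L2P; have md := mfB n.
  split=> //; apply/integrableP; split.
    by apply/measurable_EFinP; exact: cmeas_sqn md.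
  under eq_integral do rewrite gee0_abs ?lee_fin ?sqn_ge0//.
  by apply: le_lt_trans (int_lim_le n) _; rewrite ltry.
exists f.
  by rewrite -(subrK (u 0%N) f); apply: L2D.
apply: (@squeeze_cvgr _ _ _ _ (cst 0) (fun n => 2 * 2 * 2^-1 ^+ n)).
- apply: nearW => n; rewrite nsq_ge0/=.
  rewrite -opprB nsqN// nsqE -lee_fin.
  have /L2P[_ ifn] := fd n.
  rewrite /Rintegral fineK; last exact: integrable_fin_num.
  by rewrite mulrAC; exact: int_lim_le.
- exact: cvg_cst.
- rewrite -(mulr0 (2 * 2)); apply: cvgM; first exact: cvg_cst.
  by apply: cvg_expr; rewrite ger0_norm; lra.
Qed.

End FastCauchy.
End RieszFischer.

(** * The Hardy space *)

Section HardySpace.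
Variable R : realType.
Local Notation C := R[i].
Local Notation Re := complex.Re.
Implicit Types (f g h b q : C -> C) (c : nat -> C) (z w : C) (t x r : R).

Lemma sum_fctE n (F : 'I_n -> C -> C) z : (\sum_(k < n) F k) z = \sum_(k < n) F k z.
Proof. by elim/big_ind2: _ => // f1 a1 f2 a2 <- <-. Qed.

Lemma L2_sum n (F : 'I_n -> C -> C) : (forall k, L2 (F k)) -> L2 (\sum_(k < n) F k).
Proof.
by move=> F2; elim/big_ind: _ => //; [exact: (L2_cst 0)|exact: L2D].
Qed.

Lemma ip_suml n (F : 'I_n -> C -> C) g : (forall k, L2 (F k)) -> L2 g ->
  inner2 (\sum_(k < n) F k) g = \sum_(k < n) inner2 (F k) g.
Proof.
move=> F2 g2; elim: n F F2 => [|n ih] F F2; first by rewrite !big_ord0 ip0l.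
by rewrite !big_ord_recl ipDl ?ih//; exact: L2_sum.
Qed.

Lemma L2_ez k : L2 (ez k : C -> C).
Proof. exact/bdd_L2/bdd_ez. Qed.

Definition trig c n : C -> C := \sum_(k < n) cst (c k) * ez k.

Lemma L2_trig c n : L2 (trig c n).
Proof. by apply: L2_sum => k; apply: L2Z; exact: L2_ez. Qed.

Lemma ip_triglE c n g : L2 g ->
  inner2 (trig c n) g = \sum_(k < n) c k * inner2 (ez k) g.
Proof.
move=> g2; rewrite ip_suml//; last by move=> k; apply: L2Z; exact: L2_ez.
by apply: eq_bigr => k _; rewrite ipZl//; exact: L2_ez.
Qed.

Lemma cj_sum n (F : 'I_n -> C) : (\sum_(k < n) F k)^* = \sum_(k < n) (F k)^*.
Proof. exact: rmorph_sum. Qed.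

Lemma ip_trigrE c n g : L2 g ->
  inner2 g (trig c n) = \sum_(k < n) (c k)^* * inner2 g (ez k).
Proof.
move=> g2; rewrite ipC//; last exact: L2_trig.
rewrite ip_triglE// cj_sum; apply: eq_bigr => k _.
by rewrite cjM -ipC//; exact: L2_ez.
Qed.

Lemma fcoef_trig c n (k : nat) : (k < n)%N -> inner2 (trig c n) (ez k) = c k.
Proof.
move=> kn; rewrite ip_triglE; last exact: L2_ez.
rewrite (bigD1 (Ordinal kn))//= ip_ez eqxx mulr1 big1 ?addr0// => j jk.
rewrite ip_ez (_ : (j%:Z == k) = false) ?mulr0//.
by apply/negbTE; move: jk; apply: contra => /eqP[e]; apply/eqP/val_inj.
Qed.

Lemma fcoef_trig_neg c n (k : int) : k < 0 -> inner2 (trig c n) (ez k) = 0.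
Proof.
move=> kn; rewrite ip_triglE; last exact: L2_ez.
rewrite big1// => j _; rewrite ip_ez (_ : (_ == k) = false) ?mulr0//.
by apply/negbTE; rewrite gt_eqF// (lt_le_trans kn).
Qed.

Lemma ip_trig c m n : (n <= m)%N ->
  inner2 (trig c m) (trig c n) = (\sum_(k < n) sqn (c k))%:C.
Proof.
move=> nm; rewrite ip_trigrE; last exact: L2_trig.
rewrite rmorph_sum; apply: eq_bigr => k _.
by rewrite fcoef_trig ?(leq_trans _ nm)// mulrC mulcJ.
Qed.

Lemma nsq_trig c n : nsq (trig c n) = \sum_(k < n) sqn (c k).
Proof. by rewrite /nsq ip_trig. Qed.

Definition psum f n := trig (fun k => inner2 f (ez k)) n.

Lemma nsqB_psum f n : L2 f ->
  nsq (f - psum f n) = nsq f - \sum_(k < n) sqn (inner2 f (ez k)).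
Proof.
move=> f2; rewrite nsqB//; last exact: L2_trig.
rewrite nsq_trig ip_trigrE// (_ : Re _ = \sum_(k < n) sqn (inner2 f (ez k))).
  by ring.
rewrite (eq_bigr (fun k : 'I_n => (sqn (inner2 f (ez k)))%:C)).
  by rewrite -rmorph_sum.
by move=> k _; rewrite mulrC mulcJ.
Qed.

Lemma bessel f n : L2 f -> \sum_(k < n) sqn (inner2 f (ez k)) <= nsq f.
Proof. by move=> f2; rewrite -subr_ge0 -nsqB_psum// nsq_ge0. Qed.

(** Continuity of the inner product by Cauchy-Schwarz. Eventually constant sequences suffice because
    a fixed Fourier coefficient of the partial sums is eventually constant. *)
Lemma nsq_cvg_ip (u : nat -> C -> C) f g z : (forall n, L2 (u n)) -> L2 f -> L2 g ->
  nsq (u n - f) @[n --> \oo] --> (0 : R) ->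
  (\forall n \near \oo, inner2 (u n) g = z) -> inner2 f g = z.
Proof.
move=> u2 f2 g2 uf ug; apply/eqP; rewrite eq_sym -subr_eq0; apply/eqP/sqn_eq0.
apply/eqP; rewrite eq_le sqn_ge0 andbT.
have cv : nsq (u n - f) * nsq g @[n --> \oo] --> (0 : R).
  by rewrite -(mul0r (nsq g)); apply: cvgM => //; exact: cvg_cst.
rewrite -(cvg_lim _ cv)//; apply: limr_ge; first exact: cvgP cv.
apply: filterS ug => n <-; rewrite -ipBl//.
by apply: CauchySchwarz => //; exact: L2B.
Qed.

Section RieszFischerTrig.
Variables (c : nat -> C) (M : R).
Hypothesis cM : forall n, \sum_(k < n) sqn (c k) <= M.

Let S n := \sum_(k < n) sqn (c k).

Let S_nd m n : (m <= n)%N -> S m <= S n.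
Proof.
move=> mn; rewrite -(subnK mn) addnC /S big_split_ord/= lerDl.
by apply: sumr_ge0 => k _; exact: sqn_ge0.
Qed.

Let S_cauchy j : exists N, forall m, S m - S N <= 4^-1 ^+ j.
Proof.
have cvS : cvgn S.
  apply: nondecreasing_is_cvgn; first by move=> m n; exact: S_nd.
  by exists M => _ [n _ <-]; exact: cM.
have e0 : 0 < 4^-1 ^+ j :> R by rewrite exprn_gt0.
have /cvgrPdist_lt/(_ _ e0)[N _ HN] := cvS.
exists N => m; have := HN N (leqnn N) => /= hN.
have mlim : S m <= limn S.
  by apply: nondecreasing_cvgn_le => // a b; exact: S_nd.
by have := ler_norm (limn S - S N); lra.
Qed.

(** Riesz-Fischer for nonnegative frequencies, along a subsequence whose increments are small enough
    for [fast_cauchy_cvg]. The bound j <= phi j lets every coefficient settle along it. *)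
Lemma trig_cvg : exists2 g, L2 g & exists2 phi : nat -> nat,
  (forall j, j <= phi j)%N & nsq (trig c (phi j) - g) @[j --> \oo] --> (0 : R).
Proof.
have [N HN] := choice S_cauchy.
(* Cumulative sums make the indices monotone and at least [N j]; the added successors also keep them
   at least j. *)
pose phi j := (\sum_(i < j.+1) (N i).+1)%N.
have phiS j : (phi j <= phi j.+1)%N by rewrite /phi [leqRHS]big_ord_recr leq_addr.
have phiN j : (N j <= phi j)%N.
  by rewrite /phi big_ord_recr/= (leq_trans (leqnSn _))// leq_addl.
have [|g g2 gl] := @fast_cauchy_cvg R (fun j => trig c (phi j)) (fun j => L2_trig _ _).
  move=> j; rewrite nsqB ?nsq_trig; try exact: L2_trig.
  rewrite ip_trig//= -/(S _) -/(S (phi j)).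
  by have := HN j (phi j.+1); have := S_nd (phiN j); lra.
exists g => //; exists phi => //.
elim=> // j ih; rewrite (leq_ltn_trans ih)//.
by rewrite /phi [ltnRHS]big_ord_recr/= -addn1 leq_add.
Qed.

End RieszFischerTrig.

Lemma nsq_cvg0_eq f g (u : nat -> C -> C) : (forall n, L2 (u n)) -> L2 f -> L2 g ->
  nsq (u n - f) @[n --> \oo] --> (0 : R) -> eqT f g ->
  nsq (u n - g) @[n --> \oo] --> (0 : R).
Proof.
move=> u2 f2 g2 uf fg; rewrite (_ : (fun n => _) = (fun n => nsq (u n - f)))//.
by apply/funext => n; apply: nsq_ae; apply: aeS fg => t; rewrite !fctE => ->.
Qed.

Lemma H2_L2 f : H2 f -> L2 f. Proof. by case. Qed.

Lemma H2P f : H2 f <-> L2 f /\ forall k : int, k < 0 -> inner2 f (ez k) = 0.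
Proof.
by split=> -[f2 fk]; split=> // k /fk; rewrite fcoefE.
Qed.

Lemma trig_cvg_coef c g (phi : nat -> nat) : L2 g -> (forall j, j <= phi j)%N ->
  nsq (trig c (phi j) - g) @[j --> \oo] --> (0 : R) ->
  H2 g /\ forall k : nat, inner2 g (ez k) = c k.
Proof.
move=> g2 phij cg; split; [apply/H2P; split => //|] => k.
- move=> k0; apply: (nsq_cvg_ip _ g2 (L2_ez _) cg); first by move=> n; exact: L2_trig.
  by apply: nearW => n; exact: fcoef_trig_neg.
- apply: (nsq_cvg_ip _ g2 (L2_ez _) cg); first by move=> n; exact: L2_trig.
  exists k.+1 => // n /= kn; apply: fcoef_trig.
  exact: leq_trans kn (phij n).
Qed.

(** Riesz-Fischer yields a function with the coefficients of [f], equal to [f] by uniqueness.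
    Convergence along the subsequence extends to the whole sequence because the error decreases with
    n. *)
Lemma H2_psum_cvg f : H2 f -> nsq (psum f n - f) @[n --> \oo] --> (0 : R).
Proof.
move=> /H2P[f2 fk].
have [g g2 [phi phij cg]] := @trig_cvg (fun k => inner2 f (ez k)) _ (fun n => bessel n f2).
have [/H2P[_ gk] gc] := trig_cvg_coef g2 phij cg.
have gf : eqT g f.
  have : eqT (g - f) 0.
    apply: fcoef_eq0; first exact: L2B.
    move=> k; rewrite fcoefE ipBl//; last exact: L2_ez.
    case: k => n; first by rewrite gc subrr.
    by rewrite gk ?fk ?subrr.
  by apply: aeS => t /eqP; rewrite !fctE subr_eq0 => /eqP.
have {}cg := nsq_cvg0_eq (fun n => L2_trig _ _) g2 f2 cg gf.
have nE n : nsq (psum f n - f) = nsq f - \sum_(k < n) sqn (inner2 f (ez k)).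
  rewrite -nsqB_psum// -nsqN ?opprB//; apply: L2B => //; exact: L2_trig.
apply/cvgrPdist_lt => e e0; have /cvgrPdist_lt/(_ _ e0)[N _ HN] := cg.
exists (phi N) => // n /= Nn; have := HN N (leqnn N) => /=.
rewrite !sub0r !normrN !ger0_norm ?nsq_ge0// -/(psum f (phi N)) !nE.
apply: le_lt_trans; rewrite lerD2l lerN2.
rewrite -(subnK Nn) addnC big_split_ord/= lerDl.
by apply: sumr_ge0 => k _; exact: sqn_ge0.
Qed.

Lemma H2_orth f q : L2 f -> H2 q -> (forall k : nat, inner2 (ez k) f = 0) ->
  inner2 q f = 0.
Proof.
move=> f2 hq f0; have q2 := H2_L2 hq.
apply: (nsq_cvg_ip _ q2 f2 (H2_psum_cvg hq)); first by move=> n; exact: L2_trig.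
apply: nearW => n; rewrite ip_triglE// big1// => k _.
by rewrite f0 mulr0.
Qed.

(** The projection keeps the coefficients of nonnegative index; Bessel's inequality makes them
    summable by Riesz-Fischer. *)
Lemma riesz_proj f : L2 f ->
  exists2 g, H2 g & forall q, H2 q -> inner2 q (f - g) = 0.
Proof.
move=> f2; have [g g2 [phi phij cg]] := @trig_cvg (fun k => inner2 f (ez k)) _ (fun n => bessel n f2).
have [hg gc] := trig_cvg_coef g2 phij cg.
have d2 := L2B f2 g2.
exists g => // q hq; apply: H2_orth => // k.
rewrite ipC//; last exact: L2_ez.
by rewrite ipBl ?gc ?subrr ?cj0//; exact: L2_ez.
Qed.

Lemma H2D f g : H2 f -> H2 g -> H2 (f + g).
Proof.
move=> /H2P[f2 fk] /H2P[g2 gk]; apply/H2P; split; first exact: L2D.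
by move=> k k0; rewrite ipDl ?fk ?gk ?addr0//; exact: L2_ez.
Qed.

Lemma H2Z z f : H2 f -> H2 (cst z * f).
Proof.
move=> /H2P[f2 fk]; apply/H2P; split; first exact: L2Z.
by move=> k k0; rewrite ipZl ?fk ?mulr0//; exact: L2_ez.
Qed.

Lemma H2N f : H2 f -> H2 (- f).
Proof.
move=> /H2P[f2 fk]; apply/H2P; split; first exact: L2N.
by move=> k k0; rewrite ipNl ?fk ?oppr0//; exact: L2_ez.
Qed.

Lemma H2B f g : H2 f -> H2 g -> H2 (f - g).
Proof. by move=> hf hg; apply: H2D => //; exact: H2N. Qed.

Lemma H2_cst z : H2 (cst z).
Proof.
apply/H2P; split=> [|k k0]; first exact: L2_cst.
rewrite (ip_on (f' := cst z * ez 0) (g' := ez k)).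
  rewrite ipZl ?ip_ez; try exact: L2_ez.
  by rewrite gt_eqF// mulr0.
by move=> t; rewrite !fctE /ez expr0z mulr1.
Qed.

Lemma ip_mull b f g : inner2 (b * f) g = inner2 f (conjf b * g).
Proof. by apply: ip_on => t; rewrite !fctE /conjf cjM cjK; ring. Qed.

(** For k < 0 the factor [b] moves across the inner product, and conj(b) z^k is orthogonal to each
    z^j with j >= 0: their inner product is the coefficient of [b] of index k - j < 0. *)
Lemma H2M b f : bdd b -> H2 b -> H2 f -> H2 (b * f).
Proof.
move=> bb /H2P[b2 bk] hf; have f2 := H2_L2 hf.
apply/H2P; split=> [|k k0]; first exact: L2M.
rewrite ip_mull; apply: H2_orth => //.
  by apply: L2M; [exact: bdd_conj|exact: L2_ez].
move=> j; rewrite -ip_mull -[RHS](bk (k - j%:Z)); last first.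
  by rewrite (le_lt_trans _ k0)// lerBlDr lerDl.
apply: ip_on => t; rewrite !fctE !conj_ez opprB -mulrA -ezD.
by rewrite addrC.
Qed.

Lemma H2_id : H2 (id : C -> C).
Proof.
apply/H2P; split=> [|k k0]; first exact/bdd_L2/bdd_id.
rewrite (ip_on (f' := ez 1) (g' := ez k)) ?ip_ez ?gt_eqF//.
exact: lt_trans k0 _.
Qed.

Lemma H2_ez (k : nat) : H2 (ez k : C -> C).
Proof.
apply/H2P; split=> [|j j0]; first exact: L2_ez.
by rewrite ip_ez gt_eqF// (lt_le_trans j0).
Qed.

End HardySpace.

(** * Boundary values of bounded analytic functions *)

Section BoundaryValues.
Variable R : realType.
Local Notation C := R[i].
Local Notation Re := complex.Re.
Local Notation Im := complex.Im.
Implicit Types (f g h b q F : C -> C) (z w : C) (t x r : R).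

Lemma normr_Re_le z : `|Re z|%:C <= `|z|. Proof. exact: normc_ge_Re. Qed.

Lemma normr_Im_le z : `|Im z|%:C <= `|z|.
Proof.
by rewrite normc_def lecR -sqrtr_sqr ler_wsqrtr// lerDr sqr_ge0.
Qed.

Section ComplexLimit.
Context (T : Type) (G : set_system T) {FG : Filter G}.
Implicit Types (u : T -> C).

Lemma cvgC_Re u w : (u x : C^o) @[x --> G] --> (w : C^o) ->
  Re (u x) @[x --> G] --> Re w.
Proof.
move=> /cvgrPdist_lt uw; apply/cvgrPdist_lt => e e0.
have e1 : 0 < e%:C by rewrite ltcR.
apply: filterS (uw _ e1) => x; rewrite -ReN -ReD -ltcR.
exact/le_lt_trans/normr_Re_le.
Qed.

Lemma cvgC_Im u w : (u x : C^o) @[x --> G] --> (w : C^o) ->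
  Im (u x) @[x --> G] --> Im w.
Proof.
move=> /cvgrPdist_lt uw; apply/cvgrPdist_lt => e e0.
have e1 : 0 < e%:C by rewrite ltcR.
apply: filterS (uw _ e1) => x; rewrite -ImN -ImD -ltcR.
exact/le_lt_trans/normr_Im_le.
Qed.

End ComplexLimit.

Lemma Hinf_cst z : Hinf (cst z : C -> C).
Proof.
split.
- exists (fun n => if n is 0%N then z else 0) => w _.
  apply: cvg_near_cst; exists 1%N => // -[//|n] _.
  rewrite /series/= big_nat_recl// expr0 mulr1 big1 ?addr0// => i _.
  by rewrite mul0r.
- by exists (Re `|z|) => w _; rewrite RRe_real ?normr_real.
- by apply: aeW => t; exact: cvg_cst.
Qed.

Lemma HinfD F G : Hinf F -> Hinf G -> Hinf (F + G).
Proof.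
move=> [[a aF] [M FM] Fr] [[b bG] [N GN] Gr]; split.
- exists (fun n => a n + b n) => z z1.
  rewrite [X in X @ \oo](_ : _ = series (fun n => a n * z ^+ n : C^o) +
      series (fun n => b n * z ^+ n : C^o)).
    exact: cvgD (aF z z1) (bG z z1).
  apply/funext => n; rewrite /series/= !fctE -big_split/=.
  by apply: eq_bigr => k _; rewrite mulrDl.
- exists (M + N) => z z1; apply: le_trans (ler_normD _ _) _.
  by rewrite rmorphD/= lerD ?FM ?GN.
- by apply: aeS (aeI Fr Gr) => t [h1 h2]; exact: (@cvgD _ C^o _ _ _ _ _ _ _ h1 h2).
Qed.

Lemma HinfZ c F : Hinf F -> Hinf (cst c * F).
Proof.
move=> [[a aF] [M FM] Fr]; split.
- exists (fun n => c * a n) => z z1.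
  rewrite [X in X @ \oo](_ : _ = (fun n => c *: series (fun n => a n * z ^+ n : C^o) n)).
    exact: (@cvgZl_tmp _ C^o _ _ _ _ _ _ (aF z z1)).
  apply/funext => n; rewrite /series/= /GRing.scale/= mulr_sumr.
  by apply: eq_bigr => k _; rewrite mulrA.
- have ce : (Re `|c|)%:C = `|c| by apply: RRe_real; exact: normr_real.
  exists (Re `|c| * M) => z z1; rewrite !fctE normrM rmorphM [X in X * _]ce.
  by rewrite ler_wpM2l// FM.
- by apply: aeS Fr => t h1; exact: (@cvgZl_tmp _ C^o _ _ _ c _ _ h1).
Qed.

Lemma cvg_real_complex_at_left : (r%:C : C^o) @[r --> (1 : R)^'-] --> (1%:C : C^o).
Proof.
apply/cvgrPdist_lt => e e0.
have eE : e = (Re e)%:C by rewrite RRe_real// ger0_real// ltW.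
have e1 : 0 < Re e by rewrite -ltcR -eE.
have h : (fun r : R => r) @ (1 : R)^'- --> (1 : R) by apply: cvg_at_left_filter; exact: cvg_id.
move/cvgrPdist_lt/(_ _ e1) : h; apply: filterS => r hr.
rewrite eE -rmorphB/= normc_def/= expr0n/= addr0 sqrtr_sqr ltcR.
exact: hr.
Qed.

Lemma Hinf_mulid F : Hinf F -> Hinf (id * F).
Proof.
move=> [[a aF] [M FM] Fr]; split.
- exists (fun n => if n is m.+1 then a m else 0) => z z1.
  rewrite -cvg_shiftS.
  rewrite [X in X @ \oo](_ : _ = (fun n => z *: series (fun n => a n * z ^+ n : C^o) n)).
    exact: (@cvgZl_tmp _ C^o _ _ _ _ _ _ (aF z z1)).
  apply/funext => n; rewrite /series/= /GRing.scale/= big_nat_recl// mul0r add0r mulr_sumr.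
  by apply: eq_bigr => k _; rewrite exprS; ring.
- exists M => z z1; rewrite !fctE normrM (le_trans _ (FM z z1))//.
  by rewrite ler_piMl// ltW.
- apply: aeS Fr => t h1.
  have h2 := @cvgZr_tmp _ C^o _ _ _ _ _ (expi t) cvg_real_complex_at_left.
  have := @cvgZ _ C^o _ _ _ _ _ _ _ (h2 _) h1.
  by rewrite scale1r; apply.
Qed.

End BoundaryValues.

Section BoundaryFourier.
Variable R : realType.
Local Notation C := R[i].
Local Notation Re := complex.Re.
Local Notation Im := complex.Im.
Implicit Types (f g h b q F : C -> C) (z w : C) (t x r : R).

Definition nr z : R := Re `|z|.

Lemma nrE z : (nr z)%:C = `|z|.
Proof. by apply: RRe_real; exact: normr_real. Qed.

Lemma nr_ge0 z : 0 <= nr z.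
Proof. by rewrite -lecR nrE normr_ge0. Qed.

Lemma nrM z w : nr (z * w) = nr z * nr w.
Proof. by apply: complexI; rewrite rmorphM/= !nrE normrM. Qed.

Lemma nr_sum n (u : 'I_n -> C) : nr (\sum_(k < n) u k) <= \sum_(k < n) nr (u k).
Proof.
rewrite -lecR nrE rmorph_sum/=; apply: le_trans (ler_norm_sum _ _ _) _.
by rewrite le_eqVlt; apply/orP; left; apply/eqP; apply: eq_bigr => k _; rewrite nrE.
Qed.

Lemma nr_Re z : `|Re z| <= nr z.
Proof. by rewrite -lecR nrE normr_Re_le. Qed.

Lemma nr_Im z : `|Im z| <= nr z.
Proof. by rewrite -lecR nrE normr_Im_le. Qed.

Lemma nr_sqr z : nr z ^+ 2 = sqn z.
Proof. by apply: complexI; rewrite rmorphXn/= nrE -sqnE. Qed.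

Lemma nr_real r : 0 <= r -> nr r%:C = r.
Proof.
by move=> r0; apply: complexI; rewrite nrE ger0_norm// lecR.
Qed.

Lemma nr1 z : `|z| = 1 -> nr z = 1.
Proof. by rewrite /nr => ->. Qed.

Lemma nrX z n : nr (z ^+ n) = nr z ^+ n.
Proof.
elim: n => [|n ih]; first by rewrite !expr0 nr1// normr1.
by rewrite !exprS nrM ih.
Qed.

Lemma radial_lt1 r t : 0 <= r -> r < 1 -> `|r%:C * expi t| < 1.
Proof.
by move=> r0 r1; rewrite normrM norm_expi mulr1 -nrE nr_real// ltcR.
Qed.

Section PowerSeries.
Variables (F : C -> C) (a : nat -> C).
Hypothesis aF : forall z, `|z| < 1 ->
  series (fun n => a n * z ^+ n : C^o) @ \oo --> (F z : C^o).
Variable r : R.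
Hypotheses (r0 : 0 < r) (r1 : r < 1).

(** A radius strictly between r and 1: the terms at rho are bounded because the series converges
    there, so those at r are dominated by a geometric series of ratio r / rho. *)
Let rho := (1 + r) / 2.

Lemma power_series_terms_bounded : exists M, forall n, nr (a n) * rho ^+ n <= M.
Proof.
have rp : 0 < rho by rewrite divr_gt0// addr_gt0.
have rho1 : `|rho%:C| < 1 by rewrite -nrE (nr_real (ltW rp)) ltcR ltr_pdivrMr// mul1r -[ltRHS]/(1 + 1) ltrD2l.
have /cvg_series_cvg_0 := cvgP _ (aF rho1).
move=> /cvgrPdist_lt/(_ _ ltr01)[N _ HN].
exists (1 + \sum_(k < N) nr (a k) * rho ^+ k) => n.
have s0 k : 0 <= nr (a k) * rho ^+ k.
  by rewrite mulr_ge0 ?nr_ge0 ?exprn_ge0 ?ltW.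
have [Nn|nN] := leqP N n.
  have := HN n Nn; rewrite /= sub0r normrN -nrE ltcR nrM nrX nr_real ?(ltW rp)//.
  by move=> h; rewrite ltW// (lt_le_trans h)// lerDl sumr_ge0.
by rewrite (bigD1 (Ordinal nN))//= addrCA lerDl addr_ge0// sumr_ge0.
Qed.

Lemma power_series_dominated : exists M, forall n t,
  nr (trig (fun k => a k * r%:C ^+ k) n (expi t)) <= M.
Proof.
have [M HM] := power_series_terms_bounded.
have rp : 0 < rho by rewrite divr_gt0// addr_gt0.
have q1 : r / rho < 1 by rewrite ltr_pdivrMr// mul1r /rho ltr_pdivlMr// mulr_natr mulr2n ltrD2r.
have q0 : 0 < r / rho by rewrite divr_gt0.
have M0 : 0 <= M.
  by apply: le_trans (HM 0%N); rewrite mulr_ge0 ?nr_ge0 ?exprn_ge0// ltW.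
exists (M / (1 - r / rho)) => n t; rewrite /trig sum_fctE.
apply: le_trans (nr_sum _) _.
have q2 : `|r / rho| < 1 by rewrite gtr0_norm.
apply: le_trans (geometric_le_lim n M0 q0 q2).
rewrite /series/= big_mkord; apply: ler_sum => k _.
rewrite !fctE nrM nrM nrX nr_real ?(ltW r0)// (nr1 (norm_ez _ _)) mulr1.
have -> : nr (a k) * r ^+ k = nr (a k) * rho ^+ k * (r / rho) ^+ k.
  by rewrite (expr_div_n r rho) -mulrA; congr (_ * _); rewrite mulrCA divff ?mulr1// expf_neq0// gt_eqF.
by rewrite ler_wpM2r ?exprn_ge0// ltW.
Qed.

Let g z := F (r%:C * z).

Let trig_cvg t :
  Re (trig (fun k => a k * r%:C ^+ k) n (expi t)) @[n --> \oo] --> Re (g (expi t)) /\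
  Im (trig (fun k => a k * r%:C ^+ k) n (expi t)) @[n --> \oo] --> Im (g (expi t)).
Proof.
have e n : trig (fun k => a k * r%:C ^+ k) n (expi t) =
    series (fun n => a n * (r%:C * expi t) ^+ n : C^o) n.
  rewrite /trig sum_fctE /series/= big_mkord; apply: eq_bigr => k _.
  by rewrite !fctE /ez -exprnP exprMn mulrA.
have := aF (radial_lt1 t (ltW r0) r1).
rewrite (_ : series _ = fun n => (trig (fun k => a k * r%:C ^+ k) n (expi t) : C^o)).
  by move=> h; split; [exact: cvgC_Re h|exact: cvgC_Im h].
by apply/funext => n; rewrite e.
Qed.

Lemma cmeas_dilation : cmeas g.
Proof.
have mt n : cmeas (trig (fun k => a k * r%:C ^+ k) n) by apply/L2_cmeas/L2_trig.
split.
- apply: (@measurable_fun_cvg _ _ _ _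
    (fun n t => Re (trig (fun k => a k * r%:C ^+ k) n (expi t)))).
    by move=> n; have [] := mt n.
  by move=> t _; have [] := trig_cvg t.
- apply: (@measurable_fun_cvg _ _ _ _
    (fun n t => Im (trig (fun k => a k * r%:C ^+ k) n (expi t)))).
    by move=> n; have [] := mt n.
  by move=> t _; have [] := trig_cvg t.
Qed.

(** The partial sums are uniformly bounded on the circle of radius r, so their coefficients pass to
    the limit; among indices k <= 0 only the constant term contributes. *)
Lemma dilation_fcoef k : k <= 0 -> inner2 g (ez k) = if k == 0 then F 0 else 0.
Proof.
move=> k0; set c := fun n => a n * r%:C ^+ n.
have [M HM] := power_series_dominated.
have mt n : cmeas (trig c n) by apply/L2_cmeas/L2_trig.
have mk : cmeas (conjf (ez k) : C -> C) by apply: cmeas_conj; exact: cmeas_ez.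
have [||||| _ cr ci] := @cint_dominated R (fun n => trig c n * conjf (ez k))
  (g * conjf (ez k)) (fun=> M).
- by move=> n; exact: cmeasM.
- by apply: cmeasM => //; exact: cmeas_dilation.
- apply: aeW => t; have [h1 h2] := trig_cvg t.
  rewrite !fctE !ReM !ImM; split.
    under eq_fun do rewrite !fctE ReM.
    by apply: cvgB; apply: cvgM => //; exact: cvg_cst.
  under eq_fun do rewrite !fctE ImM.
  by apply: cvgD; apply: cvgM => //; exact: cvg_cst.
- exact: finite_measure_integrable_cst.
- apply: aeW => t n.
  have le : nr ((trig c n * conjf (ez k)) (expi t)) <= M.
    rewrite !fctE nrM (@nr1 (conjf (ez k) (expi t))) ?mulr1//.
    by rewrite /conjf conj_ez norm_ez.
  by split; apply: le_trans le; [exact: nr_Re|exact: nr_Im].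
have F0 : F 0 = a 0%N.
  have z1 : `|0 : C| < 1 by rewrite normr0.
  have h := aF z1.
  have e : series (fun n => a n * 0 ^+ n : C^o) @ \oo --> (a 0%N : C^o).
    apply: cvg_near_cst; exists 1%N => // -[//|n] _.
    rewrite /series/= big_nat_recl// expr0 mulr1 big1 ?addr0// => i _.
    by rewrite exprS mul0r mulr0.
  by rewrite -(cvg_lim _ h)// (cvg_lim _ e).
have ev : \forall n \near \oo, inner2 (trig c n) (ez k) = if k == 0 then F 0 else 0.
  have [->|kn] := eqVneq k 0.
    exists 1%N => // n /= n0; rewrite F0.
    by rewrite fcoef_trig// /c expr0 mulr1.
  by apply: nearW => n; rewrite fcoef_trig_neg// lt_neqAle kn k0.
set l := (X in _ = X); rewrite -/l in ev.
have lr : Re (inner2 (trig c n) (ez k)) @[n --> \oo] --> Re l.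
  by apply: cvg_near_cst; apply: filterS ev => n ->.
have li : Im (inner2 (trig c n) (ez k)) @[n --> \oo] --> Im l.
  by apply: cvg_near_cst; apply: filterS ev => n ->.
apply/eqP; rewrite eq_complex; apply/andP; split; apply/eqP.
- by rewrite -(cvg_lim _ lr)// -(cvg_lim _ cr).
- by rewrite -(cvg_lim _ li)// -(cvg_lim _ ci).
Qed.

End PowerSeries.

(** Radii form a sequence because dominated convergence and measurability of limits are sequential;
    the shift by 2 keeps the first radius positive. *)
Definition rad n : R := 1 - (n.+2%:R)^-1.

Lemma rad_gt0 n : 0 < rad n.
Proof. by rewrite subr_gt0 invf_lt1// ltr1n. Qed.

Lemma rad_lt1 n : rad n < 1.
Proof. by rewrite ltrBlDr ltrDl invr_gt0. Qed.

Lemma rad_cvg : rad n @[n --> \oo] --> (1 : R).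
Proof.
rewrite -[X in _ --> X]subr0; apply: cvgB; first exact: cvg_cst.
have := @cvg_harmonic R; rewrite -(cvg_shiftn 1); apply: cvg_trans.
by apply: near_eq_cvg; apply: nearW => n; rewrite /harmonic/= addn1.
Qed.

Lemma radial_cvg F t w : (F (r%:C * expi t) : C^o) @[r --> (1 : R)^'-] --> (w : C^o) ->
  Re (F ((rad n)%:C * expi t)) @[n --> \oo] --> Re w /\
  Im (F ((rad n)%:C * expi t)) @[n --> \oo] --> Im w.
Proof.
move=> Fw; split.
- exact: ((cvg_at_leftP (fun r => Re (F (r%:C * expi t))) 1 (Re w)).1
    (cvgC_Re Fw) rad (conj rad_lt1 rad_cvg)).
- exact: ((cvg_at_leftP (fun r => Im (F (r%:C * expi t))) 1 (Im w)).1
    (cvgC_Im Fw) rad (conj rad_lt1 rad_cvg)).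
Qed.

End BoundaryFourier.

(** * Fourier coefficients of boundary values, and inner functions *)

Section InnerFunctions.
Variable R : realType.
Local Notation C := R[i].
Local Notation P := (circ R).
Local Notation Re := complex.Re.
Local Notation Im := complex.Im.
Implicit Types (f g h b q F : C -> C) (z w : C) (t x r : R).

Lemma Hinf_bounded F : Hinf F -> exists M, forall n t,
  nr (F ((rad R n)%:C * expi t)) <= M.
Proof.
move=> [_ [M FM] _]; exists M => n t; rewrite -lecR nrE.
by apply: FM; apply: radial_lt1; [exact/ltW/rad_gt0|exact: rad_lt1].
Qed.

Lemma cvgr_sqn (u : nat -> C) w :
  Re (u n) @[n --> \oo] --> Re w -> Im (u n) @[n --> \oo] --> Im w ->
  sqn (u n) @[n --> \oo] --> sqn w.
Proof. by move=> ur ui; apply: cvgD; rewrite expr2; apply: cvgM. Qed.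

Lemma Hinf_ae_bounded F : Hinf F -> exists M, {ae P, forall t, sqn (F (expi t)) <= M}.
Proof.
move=> hF; have [M FM] := Hinf_bounded hF; have [_ _ Fr] := hF.
exists (M ^+ 2); apply: aeS Fr => t /radial_cvg[cr ci].
have cv := cvgr_sqn cr ci.
rewrite -(cvg_lim _ cv)//; apply: limr_le; first exact: cvgP cv.
apply: nearW => n; rewrite -nr_sqr lerXn2r ?nnegrE ?nr_ge0//.
by apply: le_trans (FM n t); exact: nr_ge0.
Qed.

Lemma bdd_Hinf f F : L2 f -> Hinf F -> eqT f F -> bdd f.
Proof.
move=> f2 hF fF; split; first exact: L2_cmeas.
have [M FM] := Hinf_ae_bounded hF; exists M.
by apply: aeS (aeI FM fF) => t [+ ->].
Qed.

(** Dominated convergence along the dilations, with the bound of [F] as majorant. The measurable [f]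
    stands in for the boundary values of [F], which are known only almost everywhere. *)
Lemma Hinf_fcoef F f k : Hinf F -> cmeas f -> eqT F f -> k <= 0 ->
  inner2 f (ez k) = if k == 0 then F 0 else 0.
Proof.
move=> hF mf Ff k0; have [M FM] := Hinf_bounded hF; have [[a aF] _ Fr] := hF.
have mk : cmeas (conjf (ez k) : C -> C) by apply: cmeas_conj; exact: cmeas_ez.
pose F_ n : C -> C := fun z => F ((rad R n)%:C * z).
have [||||| _ cr ci] := @cint_dominated R (fun n => F_ n * conjf (ez k))
  (f * conjf (ez k)) (fun=> M).
- move=> n; apply: cmeasM => //.
  exact: (cmeas_dilation aF (rad_gt0 R n) (rad_lt1 R n)).
- exact: cmeasM.
- apply: aeS (aeI Fr Ff) => t [/radial_cvg[h1 h2] e].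
  rewrite !fctE !ReM !ImM -e; split.
    under eq_fun do rewrite !fctE ReM.
    by apply: cvgB; apply: cvgM => //; exact: cvg_cst.
  under eq_fun do rewrite !fctE ImM.
  by apply: cvgD; apply: cvgM => //; exact: cvg_cst.
- exact: finite_measure_integrable_cst.
- apply: aeW => t n.
  have le : nr ((F_ n * conjf (ez k)) (expi t)) <= M.
    rewrite !fctE nrM (@nr1 _ (conjf (ez k) (expi t))); last first.
      by rewrite /conjf conj_ez norm_ez.
    by rewrite mulr1; exact: FM.
  by split; apply: le_trans le; [exact: nr_Re|exact: nr_Im].
have ev n : cint (F_ n * conjf (ez k)) = if k == 0 then F 0 else 0.
  exact: (dilation_fcoef aF (rad_gt0 R n) (rad_lt1 R n) k0).
rewrite ipE; apply/eqP; rewrite eq_complex; apply/andP; split; apply/eqP.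
- by rewrite -(cvg_lim _ cr)//; under eq_fun do rewrite ev; rewrite lim_cst.
- by rewrite -(cvg_lim _ ci)//; under eq_fun do rewrite ev; rewrite lim_cst.
Qed.

(* Everywhere measurable and unimodular boundary values: alpha itself is only
   required to have radial limits almost everywhere, so it may fail to be
   measurable on a null set. *)
Lemma inner_representative alpha : inner_function alpha ->
  exists a : C -> C, [/\ eqT alpha a, cmeas a,
    (forall t, `|a (expi t)| = 1), H2 a & inner2 a (ez 0) = alpha 0].
Proof.
move=> [hA A1]; have [M AM] := Hinf_bounded hA; have [[c aA] _ Ar] := hA.
(* On the circle the values are bounded, so the upper limits are finite at every point; they are
   measurable and equal the radial limit wherever it exists. *)
pose w z := limn_sup (fun n => Re (alpha ((rad R n)%:C * z))) +i*
            limn_sup (fun n => Im (alpha ((rad R n)%:C * z))).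
(* The default 1 makes the representative unimodular on the exceptional null set as well. *)
pose a z : C := if sqn (w z) == 1 then w z else 1.
have md n : cmeas (fun z => alpha ((rad R n)%:C * z)).
  exact: (cmeas_dilation aA (rad_gt0 R n) (rad_lt1 R n)).
have bRe t n : `|Re (alpha ((rad R n)%:C * expi t))| <= M.
  exact: le_trans (nr_Re _) (AM n t).
have bIm t n : `|Im (alpha ((rad R n)%:C * expi t))| <= M.
  exact: le_trans (nr_Im _) (AM n t).
have mw : cmeas w.
  split; apply: measurable_fun_limn_sup.
  - by move=> t _; exists M => _ [n _ <-]; exact: le_trans (ler_norm _) (bRe t n).
  - move=> t _; exists (- M) => _ [n _ <-].
    by have := bRe t n; rewrite ler_norml => /andP[].
  - by move=> n; have [] := md n.
  - by move=> t _; exists M => _ [n _ <-]; exact: le_trans (ler_norm _) (bIm t n).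
  - move=> t _; exists (- M) => _ [n _ <-].
    by have := bIm t n; rewrite ler_norml => /andP[].
  - by move=> n; have [] := md n.
have mb : measurable_fun [set: measurableTypeR R] (fun t => sqn (w (expi t)) == 1).
  apply: measurable_fun_eqr => //; exact: cmeas_sqn.
have ma : cmeas a.
  split.
  - rewrite (_ : (fun t => _) =
        fun t => if sqn (w (expi t)) == 1 then Re (w (expi t)) else 1).
      by apply: measurable_fun_ifT => //; have [] := mw.
    by apply/funext => t; rewrite /a; case: ifP.
  - rewrite (_ : (fun t => _) =
        fun t => if sqn (w (expi t)) == 1 then Im (w (expi t)) else 0).
      by apply: measurable_fun_ifT => //; have [] := mw.
    by apply/funext => t; rewrite /a; case: ifP.
have a1 t : `|a (expi t)| = 1.
  rewrite /a; case: eqP => [h|_]; last by rewrite normr1.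
  by rewrite -nrE; congr (_%:C); apply/eqP; rewrite -(@pexpr_eq1 _ _ 2) ?nr_ge0// nr_sqr h.
have Aa : eqT alpha a.
  apply: aeS (aeI Ar A1) => t [/radial_cvg[cr ci] n1].
  have we : w (expi t) = alpha (expi t).
    rewrite /w (cvg_limn_inf_sup cr).2 (cvg_limn_inf_sup ci).2.
    by case: (alpha _).
  by rewrite /a we sqn_unimodular ?eqxx.
exists a; split => //.
- apply/H2P; split; first exact/bdd_L2/bdd_unimodular.
  by move=> k k0; rewrite (Hinf_fcoef hA ma Aa (ltW k0)) lt_eqF.
- by rewrite (Hinf_fcoef hA ma Aa).
Qed.

End InnerFunctions.

(** * Model spaces *)

Section BackwardShift.
Variable R : realType.
Local Notation C := R[i].
Implicit Types (f g h q : C -> C) (z w c : C) (t : R).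

(* The backward shift on H^2; the conjugate kernel at 0 is [bshift a]. *)
Definition bshift g : C -> C := ez (-1) * (g - cst (inner2 g (ez 0))).

Lemma ez0E : ez 0 = cst 1 :> (C -> C).
Proof. by apply/funext => z; rewrite /ez expr0z. Qed.

Lemma one_ez : (1 : C -> C) = ez 0.
Proof. by rewrite ez0E. Qed.

Lemma L2_mulid f : L2 f -> L2 (id * f). Proof. exact/L2M/bdd_id. Qed.

Lemma H2_mulid f : H2 f -> H2 (id * f).
Proof. by apply: H2M; [exact: bdd_id|exact: H2_id]. Qed.

Lemma ip_mulid_const f c : H2 f -> inner2 (id * f) (cst c) = 0.
Proof.
move=> /H2P[f2 fk]; rewrite -[cst c]mulr1.
rewrite (ipZr c (L2_mulid f2) (L2_cst 1)) (ip_on (f' := f) (g' := ez (-1))).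
  by rewrite fk ?mulr0.
move=> t; rewrite conj_ez !fctE /ez expr1z.
by rewrite cj1 mulr1 mulrC.
Qed.

Lemma H2_bshift g : H2 g -> H2 (bshift g).
Proof.
move=> hg; have [g2 gk] := (H2P g).1 hg; have c2 := L2_cst (inner2 g (ez 0)).
apply/H2P; split; first by apply: L2M; [exact: bdd_ez|exact: L2B].
move=> k k0; rewrite (ip_on (f' := g - cst (inner2 g (ez 0))) (g' := ez (k + 1))).
  rewrite ipBl//; last exact: L2_ez.
  (* Among negative k, only k = -1 meets the constant coefficient, which the subtraction removes. *)
  have [k1|k1] := eqVneq (k + 1) 0.
    rewrite k1 -[cst _]mulr1 (ipZl _ (L2_cst 1) (L2_ez _ _)) -ez0E ip_ez eqxx.
    by rewrite mulr1 subrr.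
  have /H2P[_ ck] := H2_cst (inner2 g (ez 0)).
  have kk : k + 1 < 0 by rewrite lt_neqAle k1 lezD1.
  by rewrite gk ?ck ?subrr.
move=> t; rewrite !fctE !conj_ez mulrAC -ezD mulrC.
by congr (_ * ez _ _); rewrite opprD addrC.
Qed.

Lemma bshift_adj f g : H2 f -> H2 g -> inner2 f (bshift g) = inner2 (id * f) g.
Proof.
move=> hf hg; have f2 := H2_L2 hf; have g2 := H2_L2 hg.
have -> : inner2 f (bshift g) = inner2 (id * f) (g - cst (inner2 g (ez 0))).
  apply: ip_on => t; rewrite !fctE cjM conj_ez opprK /ez expr1z mulrA.
  by rewrite [f _ * _]mulrC.
by rewrite ipBr ?ip_mulid_const ?subr0//; [exact: L2_mulid|exact: L2_cst].
Qed.

Lemma bshiftK g t :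
  g (expi t) = inner2 g (ez 0) + expi t * bshift g (expi t).
Proof.
rewrite /bshift !fctE mulrA /ez exprN1 divff ?mul1r ?expi_neq0//.
by ring.
Qed.

End BackwardShift.

Section ModelSpace.
Variable R : realType.
Local Notation C := R[i].
Implicit Types (f g h q F : C -> C) (z w c : C) (t x r : R).

Lemma model_spaceP (a f : C -> C) : model_space a f <->
  H2 f /\ forall h, H2 h -> inner2 f (a * h) = 0.
Proof.
split=> -[hf ho]; split=> //; first by move=> h hh; apply: ho; exists h.
by move=> _ [h hh <-]; exact: ho.
Qed.

Lemma eqT_model_space (a b : C -> C) : eqT a b -> model_space a = model_space b.
Proof.
move=> ab; have e f h : inner2 f (a * h) = inner2 f (b * h).
  by apply: ip_ae; [exact: eqT_refl|apply: aeS ab => t ab; rewrite !fctE ab].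
apply/seteqP; split=> f /model_spaceP[hf ho]; apply/model_spaceP; split=> // h /ho.
  by rewrite e.
by rewrite -e.
Qed.

Variable a : C -> C.
Hypotheses (ma : cmeas a) (a1 : forall t, `|a (expi t)| = 1) (ha : H2 a).
Local Notation K := (model_space a).

Lemma bdd_inner : bdd a. Proof. exact: bdd_unimodular. Qed.
Let a2 : L2 a. Proof. exact: H2_L2. Qed.

Lemma K_H2 f : K f -> H2 f. Proof. by case/model_spaceP. Qed.
Lemma K_L2 f : K f -> L2 f. Proof. by move/K_H2/H2_L2. Qed.

Lemma L2_inner f : L2 f -> L2 (a * f). Proof. exact/L2M/bdd_inner. Qed.

Lemma H2_inner f : H2 f -> H2 (a * f).
Proof. by apply: H2M => //; exact: bdd_inner. Qed.

Lemma KD f g : K f -> K g -> K (f + g).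
Proof.
move=> /model_spaceP[hf fo] /model_spaceP[hg go]; apply/model_spaceP.
split; first exact: H2D.
move=> h hh; rewrite ipDl ?fo ?go ?addr0//; try exact: H2_L2.
exact/L2_inner/H2_L2.
Qed.

Lemma KZ c f : K f -> K (cst c * f).
Proof.
move=> /model_spaceP[hf fo]; apply/model_spaceP; split; first exact: H2Z.
move=> h hh; rewrite ipZl ?fo ?mulr0//; first exact: H2_L2.
exact/L2_inner/H2_L2.
Qed.

Lemma KB f g : K f -> K g -> K (f - g).
Proof.
move=> kf kg; rewrite (_ : f - g = f + cst (-1) * g).
  by apply: KD => //; exact: KZ.
by apply/funext => z; rewrite !fctE mulN1r.
Qed.

Lemma K0 : K 0.
Proof.
apply/model_spaceP; split; first exact: (H2_cst 0).
by move=> h _; rewrite ip0l.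
Qed.

Lemma K_orth f q : K f -> H2 q -> inner2 (a * q) f = 0.
Proof.
move=> kf hq; have /model_spaceP[hf fo] := kf.
rewrite ipC ?fo ?cj0//; first exact: H2_L2.
exact/L2_inner/H2_L2.
Qed.

Lemma K_orth1 f : K f -> inner2 a f = 0.
Proof. by move=> kf; rewrite -[a]mulr1; apply: K_orth => //; exact: (H2_cst 1). Qed.

Lemma ip_inner f g : inner2 (a * f) (a * g) = inner2 f g.
Proof.
apply: ip_on => t; rewrite !fctE cjM mulrACA mulcJ sqn_unimodular//.
by rewrite mul1r.
Qed.

(** The projection is P_+ f - a P_+(conj(a) f), with P_+ the projection onto H^2: the second term is
    the projection onto a H^2, because multiplication by [a] is isometric. *)
Lemma K_proj f : L2 f ->
  exists2 g, K g & forall h, K h -> inner2 (f - g) h = 0.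
Proof.
move=> f2; have [g1 hg1 o1] := riesz_proj f2.
have af2 : L2 (conjf a * f) by apply: L2M => //; exact/bdd_conj/bdd_inner.
have [g2 hg2 o2] := riesz_proj af2.
have ag2 := H2_inner hg2; have L1 := H2_L2 hg1; have L2' := H2_L2 hg2.
have Lag2 := H2_L2 ag2.
exists (g1 - a * g2).
  apply/model_spaceP; split; first exact: H2B.
  move=> h hh; have ah := H2_inner hh; have Lh := H2_L2 hh; have Lah := H2_L2 ah.
  have e1 : inner2 g1 (a * h) = inner2 f (a * h).
    apply/eqP; rewrite -subr_eq0 -ipBl// ipC; [|exact: Lah|exact: L2B].
    by rewrite -opprB ipNr ?o1 ?oppr0 ?cj0//; exact: L2B.
  have e2 : inner2 g2 h = inner2 (conjf a * f) h.
    apply/eqP; rewrite -subr_eq0 -ipBl// ipC; [|exact: Lh|exact: L2B].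
    by rewrite -opprB ipNr ?o2 ?oppr0 ?cj0//; exact: L2B.
  rewrite ipBl// ip_inner e1 e2; apply/eqP; rewrite subr_eq0; apply/eqP.
  by apply: ip_on => t; rewrite !fctE /conjf cjM; ring.
move=> h kh; have hh := K_H2 kh; have Lh := K_L2 kh.
rewrite (_ : f - (g1 - a * g2) = (f - g1) + a * g2); last by ring.
rewrite ipDl//; last exact: L2B.
by rewrite K_orth// addr0 ipC ?o1 ?cj0//; exact: L2B.
Qed.

Lemma K_eqT f g : K f -> K g -> (forall h, K h -> inner2 f h = inner2 g h) -> eqT f g.
Proof.
move=> kf kg e; have f2 := K_L2 kf; have g2 := K_L2 kg.
have kd := KB kf kg; have d2 := K_L2 kd.
by apply: eqT_ip => //; rewrite (ipC f2 d2) (ipC g2 d2) e.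
Qed.

Lemma orthprojP f : L2 f ->
  K (orthproj K f) /\ forall h, K h -> inner2 (orthproj K f) h = inner2 f h.
Proof.
move=> f2; have [g kg go] := K_proj f2.
have [kp po] : [set g | K g /\ forall h, K h -> inner2 (f \- g) h = 0] (orthproj K f).
  by apply: xgetPex; exists g.
split=> // h kh; have := po h kh; rewrite ipBl//; try exact: K_L2.
by move=> /eqP; rewrite subr_eq0 => /eqP ->.
Qed.

Definition acoef f : C := inner2 (id * f) a.
(** The explicit formula for the compressed shift, free of the choice made by [orthproj]; identities
    for it hold exactly, those for [cshift] only up to [eqT]. *)
Definition shift f : C -> C := id * f - cst (acoef f) * a.

(** Test against a q with q = q0 + z B q, where B is the backward shift. The constant q0 contributes
    conj(q0) a(f), cancelled by the correction term; the rest is <z f, z a B q> = <f, a B q> = 0. *)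
Lemma shiftK f : K f -> K (shift f).
Proof.
move=> kf; have /model_spaceP[hf fo] := kf; have f2 := H2_L2 hf.
have zf2 := L2_mulid f2; have ca2 := L2Z (acoef f) a2.
apply/model_spaceP; split; first by apply: H2B; [exact: H2_mulid|exact: H2Z].
move=> q hq; have q2 := H2_L2 hq; have aq2 := L2_inner q2.
set q0 := inner2 q (ez 0).
have aqE : eqT (a * q) (cst q0 * a + a * (id * bshift q)).
  by apply: eqT_on => t; rewrite !fctE [q _]bshiftK -/q0; ring.
have bq := H2_bshift hq; have b2 := H2_L2 bq.
have e1 : inner2 (id * f) (a * q) = q0^* * acoef f.
  rewrite (ip_ae (eqT_refl _) aqE) ipDr ?ipZr//; last 2 first.
  - exact: L2Z.
  - exact/L2_inner/L2_mulid.
  rewrite -[RHS]addr0; congr (_ + _); rewrite -(fo _ bq).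
  apply: ip_on => t; rewrite !fctE !cjM conj_expi.
  by field; exact: expi_neq0.
have e2 : inner2 a (a * q) = q0^*.
  rewrite -[X in inner2 X _]mulr1 ip_inner ipC ?/q0 ?ez0E//.
  exact: (L2_cst 1).
by rewrite ipBl// ipZl// e1 e2 mulrC subrr.
Qed.

Lemma ip_shift f g : L2 f -> K g -> inner2 (shift f) g = inner2 (id * f) g.
Proof.
move=> f2 kg; have g2 := K_L2 kg.
rewrite ipBl//; [|exact: L2_mulid|exact: L2Z].
by rewrite ipZl// K_orth1// mulr0 subr0.
Qed.

Lemma cshift_eqT f : K f -> eqT (cshift a f) (shift f).
Proof.
move=> kf; have f2 := K_L2 kf.
have [kp po] := orthprojP (L2_mulid f2).
by apply: K_eqT => //; [exact: shiftK|move=> h kh; rewrite po// ip_shift].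
Qed.

Lemma K_cshift f : K f -> K (cshift a f).
Proof. by move=> kf; have [] := orthprojP (L2_mulid (K_L2 kf)). Qed.

(** The hypothesis is stated so as to cover both the members of [K], which the backward shift
    preserves, and [a] itself, whose image is the conjugate kernel. *)
Lemma K_bshift g : H2 g -> (forall q, H2 q -> inner2 (id * (a * q)) g = 0) -> K (bshift g).
Proof.
move=> hg go; have hb := H2_bshift hg; apply/model_spaceP; split => // q hq.
have haq := H2_inner hq.
rewrite ipC; [|exact: H2_L2|exact: H2_L2].
by rewrite bshift_adj// go// cj0.
Qed.

(** The backward shift of [g] satisfies the universal property, so the default value of [adjoint_on]
    never arises. *)
Lemma cshift_adjP g : K g -> K (cshift_adj a g) /\
  forall f, K f -> inner2 (shift f) g = inner2 f (cshift_adj a g).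
Proof.
move=> kg; have hg := K_H2 kg.
have cE f : K f -> inner2 (cshift a f) g = inner2 (shift f) g.
  by move=> kf; apply: ip_ae; [exact: cshift_eqT|exact: eqT_refl].
have [ka ad] : [set h | K h /\
    forall f, K f -> inner2 (cshift a f) g = inner2 f h] (cshift_adj a g).
  apply: xgetPex; exists (bshift g); split.
    apply: K_bshift => // q hq; rewrite mulrCA; apply: K_orth => //.
    exact: H2_mulid.
  move=> f kf; rewrite cE// ip_shift ?bshift_adj//; [exact: K_H2|exact: K_L2].
by split=> // f kf; rewrite -ad// cE.
Qed.

Lemma K_ckernel : K (bshift a).
Proof.
apply: K_bshift => // q hq; rewrite mulrCA -[X in inner2 _ X]mulr1 ip_inner.
exact: ip_mulid_const.
Qed.

Lemma ip_ckernel f : H2 f -> inner2 f (bshift a) = acoef f.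
Proof. by move=> hf; rewrite bshift_adj. Qed.

Lemma nsq_mulid f : nsq (id * f) = nsq f.
Proof.
rewrite /nsq; congr (complex.Re _); apply: ip_on => t; rewrite !fctE cjM mulrACA.
by rewrite (mulcJ (expi t)) (sqn_unimodular (norm_expi t)) mul1r.
Qed.

(** Pythagoras: [a] is a unit vector, [acoef f] is the coefficient of z f along it, and
    multiplication by z is isometric. *)
Lemma nsq_shift f : L2 f -> nsq (shift f) = nsq f - sqn (acoef f).
Proof.
move=> f2; have zf2 := L2_mulid f2.
have na : nsq a = 1.
  rewrite /nsq -[a]mulr1 ip_inner one_ez ip_ez eqxx //.
rewrite nsqB//; last exact: L2Z.
have e : inner2 (id * f) (cst (acoef f) * a) = (sqn (acoef f))%:C.
  by rewrite ipZr// mulrC mulcJ.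
rewrite nsq_mulid nsqZ// na e /=.
by ring.
Qed.

Lemma nsq_shift_le f : L2 f -> nsq (shift f) <= nsq f.
Proof. by move=> f2; rewrite nsq_shift// lerBlDr lerDl sqn_ge0. Qed.

End ModelSpace.

(** * Density of the bounded functions in the model space *)

Section Density.
Variable R : realType.
Local Notation C := R[i].
Implicit Types (f g h q F : C -> C) (z w c : C) (t x r : R).

Variables alpha a : C -> C.
Hypotheses (hA : Hinf alpha) (Aa : eqT alpha a).
Hypotheses (ma : cmeas a) (a1 : forall t, `|a (expi t)| = 1) (ha : H2 a).
Local Notation K := (model_space a).

Definition Kinf f := K f /\ exists2 F, Hinf F & eqT f F.

Lemma Kinf_bdd f : Kinf f -> bdd f.
Proof. by move=> [kf [F hF fF]]; exact: bdd_Hinf (K_L2 kf) hF fF. Qed.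

Lemma KinfD f g : Kinf f -> Kinf g -> Kinf (f + g).
Proof.
move=> [kf [F hF fF]] [kg [G hG gG]]; split; first exact: KD.
exists (F + G); first exact: HinfD.
by apply: aeS (aeI fF gG) => t [e1 e2]; rewrite !fctE e1 e2.
Qed.

Lemma KinfZ c f : Kinf f -> Kinf (cst c * f).
Proof.
move=> [kf [F hF fF]]; split; first exact: KZ.
exists (cst c * F); first exact: HinfZ.
by apply: aeS fF => t e; rewrite !fctE e.
Qed.

Lemma Kinf_sum n (F : 'I_n -> C -> C) :
  (forall k, Kinf (F k)) -> Kinf (\sum_(k < n) F k).
Proof.
move=> FK; elim/big_ind: _ => //; last exact: KinfD.
split; first exact: K0.
by exists (cst 0); [exact: Hinf_cst|exact: eqT_refl].
Qed.

Lemma Kinf_shift f : Kinf f -> Kinf (shift a f).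
Proof.
move=> [kf [F hF fF]]; split; first exact: shiftK.
(* The analytic witness uses [alpha]: nothing is known of [a] inside the disk. *)
exists (id * F + cst (- acoef a f) * alpha).
  by apply: HinfD; [exact: Hinf_mulid|exact: HinfZ].
by apply: aeS (aeI fF Aa) => t [e1 e2]; rewrite /shift !fctE e1 e2 mulNr.
Qed.

(* The projection of z^n to the model space. *)
Definition Kproj_ez n : C -> C :=
  iter n (shift a) (cst 1 - cst (inner2 a (ez 0))^* * a).

(** This is the reproducing kernel at 0. Against a h, the constant 1 gives conj(h(0) a(0)) and [a]
    gives conj(h(0)), where the value at 0 means the coefficient of index 0. *)
Lemma Kproj_ez0 : K (Kproj_ez 0).
Proof.
set a0 := inner2 a (ez 0); have a2 := H2_L2 ha; have c2 := L2Z a0^* a2.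
have h1 := H2_cst (1 : C); have L1 := L2_cst (1 : C).
apply/model_spaceP; split; first by apply: H2B => //; exact: H2Z.
move=> h hh; have h2 := H2_L2 hh; have hah := H2_inner ma a1 ha hh.
have ah2 := H2_L2 hah; have hb := H2_bshift hh.
set h0 := inner2 h (ez 0).
have ahE : eqT (a * h) (cst h0 * a + id * (a * bshift h)).
  by apply: eqT_on => t; rewrite !fctE [h _]bshiftK -/h0; ring.
have hab := H2_inner ma a1 ha hb.
have e1 : inner2 (cst 1) (a * h) = (h0 * a0)^*.
  rewrite ipC//; congr (_^*).
  rewrite (ip_ae ahE (eqT_refl _)) ipDl ?ipZl//; last 2 first.
  - exact: L2Z.
  - exact/L2_mulid/H2_L2.
  by rewrite ip_mulid_const// addr0 /a0 ez0E.
have e2 : inner2 a (a * h) = h0^*.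
  by rewrite -[X in inner2 X _]mulr1 ip_inner// ipC ?/h0 ?ez0E.
rewrite ipBl// ipZl// e1 e2 cjM mulrC.
by apply/eqP; rewrite subr_eq0.
Qed.

Lemma Kinf_proj_ez n : Kinf (Kproj_ez n).
Proof.
elim: n => [|n ih]; last by exact: Kinf_shift.
split; first exact: Kproj_ez0.
exists (cst 1 + cst (- (inner2 a (ez 0))^*) * alpha).
  by apply: HinfD; [exact: Hinf_cst|exact: HinfZ].
by apply: aeS Aa => t e; rewrite /Kproj_ez/= !fctE e mulNr.
Qed.

(** Each shift subtracts a multiple of [a], so the discrepancy with z^n stays in a H^2, the
    orthogonal complement of [K] in H^2. *)
Lemma Kproj_ez_compl (n : nat) : exists2 q, H2 q & ez n - Kproj_ez n = a * q.
Proof.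
elim: n => [|n [q hq e]].
  exists (cst (inner2 a (ez 0))^*); first exact: H2_cst.
  by rewrite /Kproj_ez/= ez0E; ring.
exists (id * q + cst (acoef a (Kproj_ez n))).
  by apply: H2D; [exact: H2_mulid|exact: H2_cst].
rewrite /Kproj_ez iterS -/(Kproj_ez n) /shift.
have -> : ez n.+1 = id * ez n :> (C -> C).
  by apply/funext => z; rewrite !fctE /ez exprSz.
have -> : Kproj_ez n = ez n - a * q by rewrite -e; ring.
ring.
Qed.

(** A Fourier partial sum p approximates [f]; its projection [g] onto [K] is bounded. As f - p = (f
    - g) - a Q is an orthogonal decomposition, [g] is at least as close to [f] as p is. *)
Lemma Kinf_dense f (e : R) : K f -> 0 < e -> exists2 g, Kinf g & nsq (f - g) <= e.
Proof.
move=> kf e0; have hf := K_H2 kf; have f2 := K_L2 kf.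
have /cvgrPdist_lt/(_ _ e0)[N _ HN] := H2_psum_cvg hf.
have := HN N (leqnn N); rewrite /= sub0r normrN ger0_norm ?nsq_ge0// => hN.
pose c (k : 'I_N) := inner2 f (ez k).
pose g : C -> C := \sum_(k < N) cst (c k) * Kproj_ez k.
have gK : Kinf g by apply: Kinf_sum => k; apply: KinfZ; exact: Kinf_proj_ez.
have [Q hQ QE] : exists2 q, H2 q & psum f N - g = a * q.
  have qP (k : 'I_N) : exists q, H2 q /\ ez k - Kproj_ez k = a * q.
    by have [q] := Kproj_ez_compl k; exists q.
  have [q qE] := choice qP.
  exists (\sum_(k < N) cst (c k) * q k).
    elim/big_ind: _ => //; [exact: (H2_cst 0)|exact: H2D|move=> k _].
    by apply: H2Z; exact: (qE k).1.
  rewrite /psum /trig /g -sumrB mulr_sumr; apply: eq_bigr => k _.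
  by rewrite -mulrBr (qE k).2 mulrCA.
exists g => //; apply: le_trans (ltW hN).
have kd : K (f - g) by apply: KB => //; case: gK.
have d2 := K_L2 kd; have aQ2 := H2_L2 (H2_inner ma a1 ha hQ).
rewrite -(nsqN (L2B (L2_trig _ _) f2)) opprB.
have -> : f - trig (fun k : nat => inner2 f (ez k)) N = (f - g) - a * Q.
  by rewrite -QE /psum; ring.
rewrite (nsqB d2 aQ2) (ipC aQ2 d2) (K_orth ma a1 kd hQ) cj0 mulr0 subr0.
by rewrite lerDl nsq_ge0.
Qed.

End Density.

(** * The displacement equation *)

Section Displacement.
Variable R : realType.
Local Notation C := R[i].
Implicit Types (f g h q F phi psi chi : C -> C) (z w c : C) (t x r : R).

Variables alpha a b : C -> C.
Hypotheses (Aa : eqT alpha a) (a0E : inner2 a (ez 0) = alpha 0).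
Hypotheses (ma : cmeas a) (a1 : forall t, `|a (expi t)| = 1).
Local Notation Ka := (model_space a).
Local Notation Kb := (model_space b).

Variable A : (C -> C) -> (C -> C).
Hypothesis bA : bounded_operator Ka Kb A.

Lemma opK f : Ka f -> Kb (A f).
Proof. by case: bA => h _ _; exact: h. Qed.

Lemma opL2 f : Ka f -> L2 (A f).
Proof. by move=> /opK/K_L2. Qed.

Lemma opB f g : Ka f -> Ka g -> eqT (A (f - g)) (A f - A g).
Proof.
move=> kf kg; case: bA => _ lin _; have := lin (-1) g f kg kf.
have -> : (fun z => -1 * g z + f z) = f - g.
  by apply/funext => z; rewrite !fctE mulN1r addrC.
by apply: aeS => t ->; rewrite !fctE mulN1r addrC.
Qed.

Lemma op_bound : exists2 M : R, 0 <= M & forall f, Ka f -> nsq (A f) <= M * nsq f.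
Proof.
case: bA => _ _ [M AM]; exists (M ^+ 2); first exact: sqr_ge0.
move=> f kf; have := AM f kf; rewrite /norm2 -/(nsq _) -/(nsq _) => h.
have s0 := sqrtr_ge0 (nsq (A f)).
have : Num.sqrt (nsq (A f)) ^+ 2 <= (M * Num.sqrt (nsq f)) ^+ 2.
  by rewrite lerXn2r// nnegrE// (le_trans s0).
by rewrite exprMn !sqr_sqrtr// nsq_ge0.
Qed.

Lemma op_eqT f g : Ka f -> Ka g -> eqT f g -> eqT (A f) (A g).
Proof.
move=> kf kg fg; have [M M0 AM] := op_bound.
have kd := KB ma a1 kf kg.
have fg0 : eqT (f - g) 0.
  by apply: aeS fg => t e; rewrite !fctE e subrr.
have n0 : nsq (A (f - g)) = 0.
  apply/eqP; rewrite eq_le nsq_ge0 andbT; apply: le_trans (AM _ kd) _.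
  by rewrite (nsq_ae fg0) /nsq ip0l mulr0.
have z0 := nsq0_eqT (opL2 kd) n0.
apply: aeS (aeI z0 (opB kf kg)) => t [+ e].
by rewrite e !fctE => /eqP; rewrite subr_eq0 => /eqP.
Qed.

(* The difference of the two sides of (W). *)
Definition displacement psi chi f g : C :=
  inner2 (A f) g - inner2 (A (shift a f)) (shift b g) -
  (acoef a f * inner2 psi g + inner2 f chi * (acoef b g)^*).

(** At w = 0 the kernel is 1 - conj(alpha(0)) alpha, and the conjugation turns it into conj(z)
    (alpha - alpha(0)) since |alpha| = 1. The value alpha(0) is the coefficient of [a] of index
    0. *)
Lemma conj_kernel0 : eqT (conj_kernel alpha 0) (bshift a).
Proof.
apply: aeS Aa => t e; rewrite /conj_kernel /conj_op /kernel_fun e /bshift.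
rewrite !fctE a0E cj0 mul0r subr0 divr1 cjD cj1 cjN cjM cjK /ez exprN1.
rewrite conj_expi (conj_unimodular (a1 t)).
field; rewrite expi_neq0 -normr_eq0 a1 oner_eq0//.
Qed.

End Displacement.

Section Characterization.
Variable R : realType.
Local Notation C := R[i].
Implicit Types (f g h q F phi psi chi : C -> C) (z w c : C) (t x r : R).

Variables alpha a beta b : C -> C.
Hypotheses (hA : Hinf alpha) (Aa : eqT alpha a) (a0E : inner2 a (ez 0) = alpha 0).
Hypotheses (ma : cmeas a) (a1 : forall t, `|a (expi t)| = 1) (ha : H2 a).
Hypotheses (Bb : eqT beta b) (b0E : inner2 b (ez 0) = beta 0).
Hypotheses (mb : cmeas b) (b1 : forall t, `|b (expi t)| = 1) (hb : H2 b).
Local Notation Ka := (model_space a).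
Local Notation Kb := (model_space b).

Variable A : (C -> C) -> (C -> C).
Hypothesis bA : bounded_operator Ka Kb A.

Let sK f : Ka f -> Ka (shift a f). Proof. exact: shiftK. Qed.
Let sKb g : Kb g -> Kb (shift b g). Proof. exact: shiftK. Qed.

Lemma ip_bshift_conj g : H2 g -> inner2 (bshift b) g = (acoef b g)^*.
Proof.
move=> hg; rewrite ipC ?ip_ckernel//; first exact: H2_L2.
exact/H2_L2/H2_bshift.
Qed.

(** Both sides of the operator identity take values in [Kb], so they agree once they agree against
    every member of [Kb]; moving the adjoint across then gives (W). *)
Lemma displacement_eqP psi chi : Kb psi -> Ka chi ->
  (eq_operator_on Ka (fun f => A f - cshift_adj b (A (cshift a f)))
     (fun f => tensor psi (conj_kernel alpha 0) f
               + tensor (conj_kernel beta 0) chi f)) <->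
  (forall f g, Ka f -> Kb g -> displacement a b A psi chi f g = 0).
Proof.
move=> kpsi kchi.
pose D f := A f - cshift_adj b (A (cshift a f)).
pose S f : C -> C := cst (acoef a f) * psi + cst (inner2 f chi) * bshift b.
have ST f : Ka f ->
    eqT (tensor psi (conj_kernel alpha 0) f + tensor (conj_kernel beta 0) chi f) (S f).
  move=> kf; have kE := conj_kernel0 Aa a0E a1.
  apply: aeS (conj_kernel0 Bb b0E b1) => t e; rewrite /S /tensor !fctE e.
  by rewrite (ip_ae (eqT_refl f) kE) ip_ckernel//; exact: K_H2 kf.
have DK f : Ka f -> Kb (D f).
  move=> kf; apply: KB => //; first exact: (opK bA).
  by have [] := cshift_adjP mb b1 hb (opK bA (K_cshift ma a1 ha kf)).
have kB := K_ckernel mb b1 hb.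
have SK f : Kb (S f) by apply: KD => //; apply: KZ.
have Dg f g : Ka f -> Kb g ->
    inner2 (D f) g = inner2 (A f) g - inner2 (A (shift a f)) (shift b g).
  move=> kf kg; have kAs := opK bA (K_cshift ma a1 ha kf).
  have [kadj adj] := cshift_adjP mb b1 hb kAs.
  have g2 := K_L2 kg; have sg2 := K_L2 (sKb kg).
  rewrite ipBl//; [|exact: (opL2 bA)|exact: K_L2 kadj]; congr (_ - _).
  rewrite (ipC g2 (K_L2 kadj)) -adj// -(ipC sg2 (K_L2 kAs)).
  apply: ip_ae; last exact: eqT_refl.
  (* [cshift] and [shift] agree only almost everywhere, so [A] has to respect [eqT] here. *)
  apply: (op_eqT ma a1 bA); [exact: K_cshift|exact: sK|exact: cshift_eqT].
have Sg f g : Kb g ->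
    inner2 (S f) g = acoef a f * inner2 psi g + inner2 f chi * (acoef b g)^*.
  move=> kg; have g2 := K_L2 kg; have B2 := K_L2 kB; have p2 := K_L2 kpsi.
  rewrite ipDl//; [|exact: L2Z|exact: L2Z].
  by rewrite !ipZl// ip_bshift_conj//; exact: K_H2 kg.
split=> [eqAB f g kf kg|d0 f kf].
  rewrite /displacement -Dg// -Sg//; apply/eqP; rewrite subr_eq0; apply/eqP.
  apply: ip_ae; last exact: eqT_refl.
  exact: eqT_trans (eqAB f kf) (ST f kf).
apply: eqT_trans (eqT_sym (ST f kf)).
apply: (K_eqT mb b1) => //; first exact: DK.
move=> g kg; rewrite Dg// Sg//; apply/eqP; rewrite -subr_eq0; apply/eqP.
exact: d0.
Qed.

Lemma displacement_bound psi chi g : Kb psi -> Ka chi -> Kb g ->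
  exists2 M : R, 0 <= M &
    forall f, Ka f -> sqn (displacement a b A psi chi f g) <= M * nsq f.
Proof.
move=> kpsi kchi kg; have [M M0 AM] := op_bound bA.
have g2 := K_L2 kg; have c2 := K_L2 kchi; have p2 := K_L2 kpsi.
have sg := sKb kg; have sg2 := K_L2 sg.
(* Two nested uses of |z + w|^2 <= 2 (|z|^2 + |w|^2) give the factor 4; the two terms with [A] share
   the bound M |f|^2 |g|^2, hence the inner 2. *)
exists (4 * (2 * M * nsq g + nsq psi * nsq g + nsq chi * sqn (acoef b g))).
  by rewrite mulr_ge0 ?addr_ge0 ?mulr_ge0 ?nsq_ge0 ?sqn_ge0.
move=> f kf; have f2 := K_L2 kf; have ks := sK kf.
have sqnB z w : sqn (z - w) <= 2 * (sqn z + sqn w).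
  by apply: le_trans (sqnD_le _ _) _; rewrite /sqn ReN ImN !sqrrN.
have b1' : sqn (inner2 (A f) g) <= M * nsq f * nsq g.
  apply: le_trans (CauchySchwarz (opL2 bA kf) g2) _.
  by rewrite ler_wpM2r ?nsq_ge0// AM.
have b2 : sqn (inner2 (A (shift a f)) (shift b g)) <= M * nsq f * nsq g.
  apply: le_trans (CauchySchwarz (opL2 bA ks) sg2) _.
  apply: ler_pM; rewrite ?nsq_ge0//; last exact: nsq_shift_le.
  by apply: le_trans (AM _ ks) _; rewrite ler_wpM2l// nsq_shift_le.
have b3 : sqn (acoef a f * inner2 psi g) <= nsq f * (nsq psi * nsq g).
  rewrite sqnM ler_pM ?sqn_ge0 ?CauchySchwarz//.
  (* The bound |a(f)|^2 <= |f|^2 is the positivity of |S f|^2. *)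
  by rewrite -subr_ge0 -(nsq_shift a1 ha f2) nsq_ge0.
have b4 : sqn (inner2 f chi * (acoef b g)^*) <= nsq f * nsq chi * sqn (acoef b g).
  by rewrite sqnM sqn_conj ler_wpM2r ?sqn_ge0// CauchySchwarz.
apply: le_trans (sqnB _ _) _.
have b5 := sqnB (inner2 (A f) g) (inner2 (A (shift a f)) (shift b g)).
have b6 := sqnD_le (acoef a f * inner2 psi g) (inner2 f chi * (acoef b g)^*).
move: b1' b2 b3 b4 b5 b6.
move: (sqn (inner2 (A f) g)) (sqn (inner2 (A (shift a f)) (shift b g))).
move: (sqn (acoef a f * inner2 psi g)) (sqn (inner2 f chi * (acoef b g)^*)).
move: (sqn (_ - _)) => x5; move: (sqn (_ + _)) => x6; move: (sqn (acoef b g)) => y.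
move: (nsq f) (nsq g) (nsq psi) (nsq chi) => nf ng np nc x3 x4 x1 x2.
move=> b1' b2 b3 b4 b5 b6; lra.
Qed.

Lemma acoefB (c f g : C -> C) : L2 c -> L2 f -> L2 g ->
  acoef c (f - g) = acoef c f - acoef c g.
Proof.
move=> c2 f2 g2; rewrite /acoef mulrBr ipBl//; exact: L2_mulid.
Qed.

Lemma displacementB psi chi g f f' : Kb psi -> Ka chi -> Kb g -> Ka f -> Ka f' ->
  displacement a b A psi chi (f - f') g =
  displacement a b A psi chi f g - displacement a b A psi chi f' g.
Proof.
move=> kpsi kchi kg kf kf'; have a2 := H2_L2 ha.
have f2 := K_L2 kf; have f2' := K_L2 kf'; have g2 := K_L2 kg.
have acB := acoefB a2 f2 f2'.
have sB : shift a (f - f') = shift a f - shift a f'.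
  rewrite /shift acB (_ : cst (_ - _) = cst (acoef a f) - cst (acoef a f'))//; ring.
have c2 := K_L2 kchi; have sg2 := K_L2 (sKb kg).
rewrite /displacement acB sB (ipBl f2 f2' c2).
rewrite (ip_ae (opB bA kf kf') (eqT_refl g)).
rewrite (ip_ae (opB bA (sK kf) (sK kf')) (eqT_refl (shift b g))).
rewrite (ipBl (opL2 bA kf) (opL2 bA kf') g2).
rewrite (ipBl (opL2 bA (sK kf)) (opL2 bA (sK kf')) sg2).
move: (inner2 (A f) g) (inner2 (A f') g) (inner2 (A (shift a f)) _) => x1 x2 x3.
move: (inner2 (A _) _) (inner2 psi g) (inner2 f chi) (inner2 f' chi) => x4 x5 x6 x7.
by move: (acoef a f) (acoef a f') (_^*) => x8 x9 x10; ring.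
Qed.

Lemma sqn_eq0_le z (M : R) : 0 <= M -> (forall e, 0 < e -> sqn z <= M * e) -> z = 0.
Proof.
move=> M0 h; apply: sqn_eq0; apply/eqP; rewrite eq_le sqn_ge0 andbT.
apply/ler_addgt0Pr => e e0; rewrite add0r.
apply: le_trans (h (e / (M + 1)) _) _; first by rewrite divr_gt0// ltr_wpDl.
rewrite mulrCA ler_piMr ?(ltW e0)// ler_pdivrMr ?ltr_wpDl//.
by rewrite mul1r lerDl.
Qed.

Lemma displacement_dense psi chi : Kb psi -> Ka chi ->
  (forall f g, Kinf a f -> Kb g -> displacement a b A psi chi f g = 0) ->
  forall f g, Ka f -> Kb g -> displacement a b A psi chi f g = 0.
Proof.
move=> kpsi kchi d0 f g kf kg; have [M M0 dM] := displacement_bound kpsi kchi kg.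
apply: (sqn_eq0_le M0) => e e0.
have [f' kf' ff'] := Kinf_dense hA Aa ma a1 ha kf e0.
have kK' := kf'.1.
have := displacementB kpsi kchi kg kf kK'; rewrite (d0 _ _ kf' kg) subr0 => <-.
apply: le_trans (dM _ (KB ma a1 kf kK')) _.
by rewrite ler_wpM2l.
Qed.

End Characterization.

(** * From a symbol to the displacement equation *)

Section SymbolToDisplacement.
Variable R : realType.
Local Notation C := R[i].
Implicit Types (f g h q F phi psi chi : C -> C) (z w c : C) (t x r : R).

Variables a b : C -> C.
Hypotheses (ma : cmeas a) (a1 : forall t, `|a (expi t)| = 1) (ha : H2 a).
Hypotheses (mb : cmeas b) (b1 : forall t, `|b (expi t)| = 1) (hb : H2 b).
Local Notation Ka := (model_space a).
Local Notation Kb := (model_space b).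
Variable A : (C -> C) -> (C -> C).

(** Of the four terms of <phi S f, S g>, the one with <z phi f, z g> cancels <phi f, g>, and two
    give the pairings with the projections of [psi0] and [chi0]. The cross term a(f) conj(b(g)) <V,
    b> is put into [psi]; it has the shape of either summand. *)
Lemma symbol_displacement phi : L2 phi ->
  (forall f, Kinf a f -> Kinf a (shift a f)) ->
  (forall f, Kinf a f -> eqT (A f) (atto b phi f)) ->
  exists psi chi, [/\ Kb psi, Ka chi & forall f g, Kinf a f -> Kb g ->
    displacement a b A psi chi f g = 0].
Proof.
move=> phi2 sKinf Aphi.
have a2 := H2_L2 ha; have b2 := H2_L2 hb.
have ba := bdd_inner ma a1; have bb := bdd_inner mb b1.
pose V := a * phi; have V2 : L2 V by exact: L2M.
pose chi0 := ez (-1) * (b * conjf phi).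
have chi02 : L2 chi0.
  by apply: L2M; [exact: bdd_ez|apply: L2M => //; exact: L2_conj].
pose psi0 := ez (-1) * V.
have psi02 : L2 psi0 by apply: L2M => //; exact: bdd_ez.
have [kchi chiE] := orthprojP ma a1 ha chi02.
have [kpsi psiE] := orthprojP mb b1 hb psi02.
have kB := K_ckernel mb b1 hb.
set c := inner2 V b.
exists (orthproj Kb psi0 - cst c * bshift b), (orthproj Ka chi0).
split=> //; first by apply: KB => //; exact: KZ.
move=> f g fK kg; have kf := fK.1; have bf := Kinf_bdd fK.
have f2 := K_L2 kf; have g2 := K_L2 kg.
have AE h k : Kinf a h -> Kb k -> inner2 (A h) k = inner2 (h * phi) k.
  move=> hK kk; have h2 : L2 (h * phi) by apply: L2M => //; exact: Kinf_bdd hK.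
  have [_ <-//] := orthprojP mb b1 hb h2.
  by rewrite (ip_ae (Aphi h hK) (eqT_refl k)) /atto (mulrC h).
pose X := f * phi; have X2 : L2 X by exact: L2M.
have sgK := shiftK mb b1 hb kg.
rewrite /displacement (AE _ _ fK kg) (AE _ _ (sKinf _ fK) sgK) -/X.
have zX2 := L2_mulid X2; have zg2 := L2_mulid g2.
have caV2 := L2Z (acoef a f) V2; have cbb2 := L2Z (acoef b g) b2.
have -> : shift a f * phi = id * X - cst (acoef a f) * V by rewrite /shift /X /V; ring.
rewrite /shift (ipBl zX2 caV2 (L2B zg2 cbb2)).
rewrite (ipBr zX2 zg2 cbb2) (ipBr caV2 zg2 cbb2).
rewrite (ipZr _ zX2 b2) !(ipZl _ V2) // (ipZr _ V2 b2).
(* [ip_inner] needs only unimodularity, so it applies to the function z itself. *)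
have -> : inner2 (id * X) (id * g) = inner2 X g by exact: ip_inner (@norm_expi R) _ _.
have -> : inner2 f (orthproj Ka chi0) = inner2 (id * X) b.
  rewrite (ipC (K_L2 kchi) f2) chiE// -(ipC chi02 f2).
  apply: ip_on => t; rewrite /chi0 /X /conjf !fctE !cjM cjK conj_ez opprK /ez expr1z.
  by ring.
have -> : inner2 (orthproj Kb psi0 - cst c * bshift b) g =
    inner2 V (id * g) - c * (acoef b g)^*.
  rewrite (ipBl (K_L2 kpsi) (L2Z c (K_L2 kB)) g2) psiE// (ipZl c (K_L2 kB) g2).
  rewrite (ip_bshift_conj hb (K_H2 kg)); congr (_ - _).
  by apply: ip_on => t; rewrite /psi0 !fctE cjM conj_expi /ez exprN1; ring.
rewrite -/c.
move: (inner2 X g) (inner2 _ b) (inner2 V _) c => x1 x2 x3 x4.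
by move: (acoef a f) (_^*) => x5 x6; ring.
Qed.

End SymbolToDisplacement.

(** * From the displacement equation to a symbol *)

Section DisplacementToSymbol.
Variable R : realType.
Local Notation C := R[i].
Implicit Types (f g h q F phi psi chi : C -> C) (z w c : C) (t x r : R).

Section Iterates.
Variable a : C -> C.
Hypotheses (ma : cmeas a) (a1 : forall t, `|a (expi t)| = 1) (ha : H2 a).
Local Notation K := (model_space a).

Let ba : bdd a. Proof. exact: bdd_inner. Qed.
Let a2 : L2 a. Proof. exact: H2_L2. Qed.

(** This agrees on the circle with [conj_op a]; conj(z) is written as an exponential to ease the
    computation of coefficients. *)
Definition cconj f : C -> C := a * (ez (-1) * conjf f).

Lemma L2_cconj f : L2 f -> L2 (cconj f).
Proof.
move=> f2; apply: L2M => //; apply: L2M; first exact: bdd_ez.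
exact: L2_conj.
Qed.

(** The coefficient of index -(m + 1) is the conjugate of <f, a z^m>, which vanishes because [f] is
    orthogonal to a H^2. *)
Lemma H2_cconj f : K f -> H2 (cconj f).
Proof.
move=> kf; have f2 := K_L2 kf; apply/H2P; split; first exact: L2_cconj.
case=> // m _; have am := L2_inner ma a1 (L2_ez R m).
have /model_spaceP[_ fo] := kf.
rewrite -[RHS]cj0 -(fo _ (H2_ez R m)) -(ipC f2 am).
apply: ip_on => t; rewrite /cconj /conjf !fctE conj_ez NegzE opprK.
have -> : ez m (expi t) = ez (-1) (expi t) * ez m.+1 (expi t).
  by rewrite -ezD -addn1 PoszD addrC addrK.
ring.
Qed.

Lemma nsq_cconj f : nsq (cconj f) = nsq f.
Proof.
rewrite !nsqE; apply: eq_Rintegral => t _; rewrite /cconj /conjf !fctE !sqnM.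
by rewrite (sqn_unimodular (a1 t)) (sqn_unimodular (norm_ez _ _)) sqn_conj !mul1r.
Qed.

Lemma K_iter n f : K f -> K (iter n (shift a) f).
Proof. by move=> kf; elim: n => //= n ih; exact: shiftK. Qed.

(** The corrections made by successive shifts stay in a H^2, so S^n f is the projection of z^n f and
    may be replaced by it against members of [K]. *)
Lemma iter_shift_compl (n : nat) f : K f ->
  exists2 q, H2 q & ez n * f - iter n (shift a) f = a * q.
Proof.
move=> kf; elim: n => [|n [q hq e]].
  exists (cst 0); first exact: H2_cst.
  rewrite /= ez0E; apply/funext => z; rewrite !fctE mul1r mulr0; exact: subrr.
exists (id * q + cst (acoef a (iter n (shift a) f))).
  by apply: H2D; [exact: H2_mulid|exact: H2_cst].
have -> : ez n.+1 = id * ez n :> (C -> C).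
  by apply/funext => z; rewrite !fctE /ez exprSz.
rewrite iterS {1}/shift.
have -> : iter n (shift a) f = ez n * f - a * q by rewrite -e; ring.
ring.
Qed.

Lemma ip_iter_shift (n : nat) f h : K f -> K h ->
  inner2 (iter n (shift a) f) h = inner2 (ez n * f) h.
Proof.
move=> kf kh; have [q hq e] := iter_shift_compl n kf.
have kn := K_iter n kf.
have zf2 : L2 (ez n * f) by apply: L2M; [exact: bdd_ez|exact: K_L2 kf].
apply/esym/eqP; rewrite -subr_eq0 -(ipBl zf2 (K_L2 kn) (K_L2 kh)) e.
by rewrite K_orth.
Qed.

(** Replacing S^n f by z^n f - a q costs nothing, as <z a q, a> = <z q, 1> = 0; the conjugate of
    <z^(n+1) f, a> is then the coefficient. *)
Lemma acoef_iter (n : nat) f : K f ->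
  (acoef a (iter n (shift a) f))^* = inner2 (cconj f) (ez n).
Proof.
move=> kf; have [q hq e] := iter_shift_compl n kf; have f2 := K_L2 kf.
have zf2 : L2 (ez n * f) by apply: L2M => //; exact: bdd_ez.
have aq2 := L2_inner ma a1 (H2_L2 hq).
have -> : acoef a (iter n (shift a) f) = inner2 (id * (ez n * f)) a.
  have -> : iter n (shift a) f = ez n * f - a * q by rewrite -e; ring.
  rewrite (acoefB a2 zf2 aq2) {2}/acoef mulrCA.
  have -> : inner2 (a * (id * q)) a = inner2 (id * q) (cst 1).
    by rewrite -[X in inner2 _ X]mulr1 ip_inner.
  by rewrite ip_mulid_const ?subr0.
rewrite -(ipC (L2_mulid zf2) a2); apply: ip_on => t.
rewrite /cconj /conjf !fctE !cjM conj_ez conj_expi /ez exprN1; ring.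
Qed.

Lemma nsq_iter n f : K f ->
  nsq (iter n (shift a) f) = nsq (psum (cconj f) n - cconj f).
Proof.
move=> kf; have c2 := L2_cconj (K_L2 kf).
rewrite -[RHS]nsqN; last by apply: L2B => //; exact: L2_trig.
rewrite opprB nsqB_psum// nsq_cconj.
elim: n => [|n ih]; first by rewrite big_ord0 subr0.
have kn := K_L2 (K_iter n kf).
rewrite iterS (nsq_shift a1 ha kn) ih big_ord_recr/= -acoef_iter// sqn_conj.
by move: (sqn (acoef _ _)) => x; rewrite opprD addrA.
Qed.

End Iterates.

Variables a beta b : C -> C.
Hypotheses (ma : cmeas a) (a1 : forall t, `|a (expi t)| = 1) (ha : H2 a).
Hypotheses (hB : Hinf beta) (Bb : eqT beta b).
Hypotheses (mb : cmeas b) (b1 : forall t, `|b (expi t)| = 1) (hb : H2 b).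
Local Notation Ka := (model_space a).
Local Notation Kb := (model_space b).
Variable A : (C -> C) -> (C -> C).
Hypothesis bA : bounded_operator Ka Kb A.
Variables psi chi : C -> C.
Hypotheses (kpsi : Kb psi) (kchi : Ka chi).
Hypothesis d0 : forall f g, Ka f -> Kb g -> displacement a b A psi chi f g = 0.

(** The sums over all k of the telescoped identity are <conj(g) psi, C_a f> and <C_b g, conj(f)
    chi>; these integrals are the two summands below times f conj(g). *)
Definition symbol : C -> C :=
  id * (conjf a * psi) + ez (-1) * (b * conjf chi).

Lemma L2_symbol : L2 symbol.
Proof.
apply: L2D; (apply: L2M; [exact: bdd_id || exact: bdd_ez|]).
  by apply: L2M; [exact/bdd_conj/bdd_inner|exact: K_L2 kpsi].
by apply: L2M; [exact: bdd_inner|exact/L2_conj/(K_L2 kchi)].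
Qed.

Lemma displacement_telescope n f g : Ka f -> Kb g ->
  inner2 (A f) g = \sum_(k < n) ((inner2 (cconj a f) (ez k))^* * inner2 psi (ez k * g)
     + inner2 (ez k * f) chi * inner2 (cconj b g) (ez k))
  + inner2 (A (iter n (shift a) f)) (iter n (shift b) g).
Proof.
move=> kf kg; elim: n => [|n ->]; first by rewrite big_ord0 add0r.
rewrite big_ord_recr/= -addrA; congr (_ + _).
have kfn := K_iter ma a1 ha n kf; have kgn := K_iter mb b1 hb n kg.
have := d0 kfn kgn; rewrite /displacement => /eqP; rewrite subr_eq0 subr_eq => /eqP ->.
congr (_ * _ + _ * _ + _).
- by rewrite -(acoef_iter ma a1 ha n kf) cjK.
- have g2 := K_L2 kg; have p2 := K_L2 kpsi.
  have zg2 : L2 (ez n * g) by apply: L2M => //; exact: bdd_ez.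
  rewrite (ipC (K_L2 kgn) p2) (ip_iter_shift mb b1 hb)//.
  by rewrite -(ipC zg2 p2).
- exact: ip_iter_shift.
- exact: acoef_iter.
Qed.

Lemma symbol_ip f g : Kinf a f -> Kinf b g ->
  inner2 (A f) g = inner2 (f * symbol) g.
Proof.
move=> fK gK; have kf := fK.1; have kg := gK.1.
have bf := Kinf_bdd fK; have bg := Kinf_bdd gK.
have f2 := K_L2 kf; have g2 := K_L2 kg; have p2 := K_L2 kpsi; have c2 := K_L2 kchi.
have pg2 : L2 (conjf g * psi) by apply: L2M => //; exact: bdd_conj.
have cf2 : L2 (conjf f * chi) by apply: L2M => //; exact: bdd_conj.
have Cf := H2_cconj ma a1 kf; have Cg := H2_cconj mb b1 kg.
have Cf2 := H2_L2 Cf; have Cg2 := H2_L2 Cg.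
have [M M0 AM] := op_bound bA.
apply/eqP; rewrite -subr_eq0; apply/eqP.
set u := fun n => nsq (psum (cconj a f) n - cconj a f).
set v := fun n => nsq (psum (cconj b g) n - cconj b g).
have cu : u n @[n --> \oo] --> (0 : R) by exact: H2_psum_cvg.
have cv : v n @[n --> \oo] --> (0 : R) by exact: H2_psum_cvg.
set d := (X in X = 0).
(* The error is a sum of three terms, two tails of Fourier sums and the remainder, each bounded by
   Cauchy-Schwarz. The weights 4, 4, 2 come from two uses of [sqnD_le]. *)
pose B n := 4 * (nsq (conjf g * psi) * u n + v n * nsq (conjf f * chi)) +
  2 * (M * u n * nsq g).
have dB n : sqn d <= B n.
  have dE : d = inner2 (conjf g * psi) (psum (cconj a f) n - cconj a f)
      + inner2 (psum (cconj b g) n - cconj b g) (conjf f * chi)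
      + inner2 (A (iter n (shift a) f)) (iter n (shift b) g).
    rewrite /d (displacement_telescope n kf kg) big_split/=.
    have -> : \sum_(k < n) (inner2 (cconj a f) (ez k))^* * inner2 psi (ez k * g) =
        inner2 (conjf g * psi) (psum (cconj a f) n).
      rewrite ip_trigrE//; apply: eq_bigr => k _; congr (_ * _).
      by apply: ip_on => t; rewrite /conjf !fctE cjM; ring.
    have -> : \sum_(k < n) inner2 (ez k * f) chi * inner2 (cconj b g) (ez k) =
        inner2 (psum (cconj b g) n) (conjf f * chi).
      rewrite ip_triglE//; apply: eq_bigr => k _; rewrite mulrC; congr (_ * _).
      by apply: ip_on => t; rewrite /conjf !fctE cjM cjK; ring.
    have -> : inner2 (f * symbol) g =
        inner2 (conjf g * psi) (cconj a f) + inner2 (cconj b g) (conjf f * chi).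
      have L1 : L2 (f * (id * (conjf a * psi))).
        apply: L2M => //; apply: L2_mulid; apply: L2M => //.
        exact/bdd_conj/bdd_inner.
      have L2' : L2 (f * (ez (-1) * (b * conjf chi))).
        apply: L2M => //; apply: L2M; first exact: bdd_ez.
        by apply: L2M; [exact: bdd_inner|exact: L2_conj].
      rewrite /symbol mulrDr (ipDl L1 L2' g2); congr (_ + _).
        apply: ip_on => t; rewrite /cconj /conjf !fctE !cjM conj_ez cjK opprK /ez expr1z.
        ring.
      apply: ip_on => t; rewrite /cconj /conjf !fctE !cjM cjK; ring.
    rewrite (ipBr pg2 (L2_trig _ _) Cf2) (ipBl (L2_trig _ _) Cg2 cf2) -/(psum _ _).
    rewrite -/(psum (cconj b g) n).
    move: (inner2 _ (psum _ _)) (inner2 (psum _ _) _) (inner2 (A _) _) => x1 x2 x3.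
    by move: (inner2 _ (cconj a f)) (inner2 (cconj b g) _) => x4 x5; ring.
  have kfn := K_iter ma a1 ha n kf; have kgn := K_iter mb b1 hb n kg.
  have uL : L2 (psum (cconj a f) n - cconj a f) by apply: L2B => //; exact: L2_trig.
  have vL : L2 (psum (cconj b g) n - cconj b g) by apply: L2B => //; exact: L2_trig.
  have s1 := CauchySchwarz pg2 uL; have s2 := CauchySchwarz vL cf2.
  have s3 : sqn (inner2 (A (iter n (shift a) f)) (iter n (shift b) g)) <=
      M * u n * nsq g.
    apply: le_trans (CauchySchwarz (opL2 bA kfn) (K_L2 kgn)) _.
    apply: ler_pM; rewrite ?nsq_ge0//.
      by rewrite /u -(nsq_iter ma a1 ha)// AM.
    (* The iterates of [g] need only stay bounded, as the factor with [f] already tends to 0; the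
       compressed shift is a contraction. *)
    elim: n {s1 s2 uL vL dE kfn kgn} => //= n ih.
    by apply: le_trans ih; apply: nsq_shift_le => //; exact/K_L2/K_iter.
  rewrite dE; apply: le_trans (sqnD_le _ _) _.
  have := sqnD_le (inner2 (conjf g * psi) (psum (cconj a f) n - cconj a f))
     (inner2 (psum (cconj b g) n - cconj b g) (conjf f * chi)).
  rewrite /B; move: s1 s2 s3; rewrite -/(u n) -/(v n).
  move: (sqn (inner2 (A _) _)) => y3; move: (sqn (_ + _)) => y12.
  move: (sqn (inner2 (conjf g * psi) _)) => y1; move: (sqn (inner2 _ _)) => y2.
  by move: (_ * u n) (_ * nsq g) (v n * _) => z1 z3 z2; lra.
have cB : B n @[n --> \oo] --> (0 : R).
  have -> : (0 : R) = 4 * (nsq (conjf g * psi) * 0 + 0 * nsq (conjf f * chi)) +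
      2 * (M * 0 * nsq g) by ring.
  apply: cvgD; apply: cvgMl_tmp.
    by apply: cvgD; [exact: cvgMl_tmp|exact: cvgMr_tmp].
  by apply: cvgMr_tmp; exact: cvgMl_tmp.
apply: sqn_eq0; apply/eqP; rewrite eq_le sqn_ge0 andbT.
rewrite -(cvg_lim _ cB)//; apply: limr_ge; first exact: cvgP cB.
exact: nearW.
Qed.

(** For bounded [f] the function A f - phi f lies in L^2. It is orthogonal to the bounded members of
    [Kb], hence by density to all of [Kb], which identifies A f with the projection of phi f. *)
Lemma symbol_atto f : Kinf a f -> eqT (A f) (atto b symbol f).
Proof.
move=> fK; have kf := fK.1; have bf := Kinf_bdd fK.
have sf2 : L2 (symbol * f) by rewrite mulrC; apply: L2M => //; exact: L2_symbol.
have [ko oE] := orthprojP mb b1 hb sf2.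
apply: (K_eqT mb b1) => //; first exact: (opK bA).
move=> g kg; rewrite /atto oE// (mulrC symbol).
have g2 := K_L2 kg; have fs2 : L2 (f * symbol) by rewrite mulrC.
have Af2 := opL2 bA kf; have h2 := L2B Af2 fs2.
apply/eqP; rewrite -subr_eq0 -(ipBl Af2 fs2 g2); apply/eqP.
apply: (sqn_eq0_le (nsq_ge0 (A f - f * symbol))) => e e0.
have [g' gK' gg'] := Kinf_dense hB Bb mb b1 hb kg e0.
have g2' := K_L2 gK'.1.
have z' : inner2 (A f - f * symbol) g' = 0.
  by rewrite (ipBl Af2 fs2 g2') symbol_ip// subrr.
have -> : inner2 (A f - f * symbol) g = inner2 (A f - f * symbol) (g - g').
  by rewrite (ipBr h2 g2 g2') z' subr0.
apply: le_trans (CauchySchwarz h2 (L2B g2 g2')) _.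
by rewrite ler_wpM2l// nsq_ge0.
Qed.

End DisplacementToSymbol.

Theorem corollary2p4 (R : realType) (alpha beta : R[i] -> R[i])
    (halpha : inner_function alpha) (hbeta : inner_function beta)
    (A : (R[i] -> R[i]) -> (R[i] -> R[i]))
    (hA : bounded_operator (model_space alpha) (model_space beta) A) :
  TTO alpha beta A <->
  exists psi chi : R[i] -> R[i],
    [/\ model_space beta psi, model_space alpha chi &
        eq_operator_on (model_space alpha)
          (fun f => A f - cshift_adj beta (A (cshift alpha f)))%R
          (fun f => tensor psi (conj_kernel alpha 0%R) f
                    + tensor (conj_kernel beta 0%R) chi f)%R].
Proof.
have [a [Aa ma a1 ha a0]] := inner_representative halpha.
have [b [Bb mb b1 hb b0]] := inner_representative hbeta.
have [Halpha _] := halpha; have [Hbeta _] := hbeta.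
have ea := eqT_model_space Aa; have eb := eqT_model_space Bb.
have bA : bounded_operator (model_space a) (model_space b) A by rewrite -ea -eb.
(* These operators see the inner function only through its model space, a set unchanged by the new
   representative, so they are equal outright. Only the conjugate kernels still mention the original
   functions. *)
have -> : cshift alpha = cshift a by rewrite /cshift ea.
have -> : cshift_adj beta = cshift_adj b by rewrite /cshift_adj /cshift eb.
have attoE phi : atto beta phi = atto b phi by rewrite /atto eb.
rewrite ea eb; split.
- move=> [_ [phi phi2 Aphi]].
  have [||psi [chi [kpsi kchi d0]]] := @symbol_displacement R a b ma a1 ha mb b1 hb A phi phi2.
  + by move=> f; exact: (Kinf_shift Halpha Aa ma a1 ha).
  + move=> f [kf hf]; rewrite -attoE; apply: Aphi; rewrite /model_space_inf ea.
    by split.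
  exists psi, chi; split => //.
  apply/(displacement_eqP Aa a0 ma a1 ha Bb b0 mb b1 hb bA kpsi kchi).
  exact: (displacement_dense Halpha Aa ma a1 ha mb b1 hb bA kpsi kchi d0).
- move=> [psi [chi [kpsi kchi]]].
  move/(displacement_eqP Aa a0 ma a1 ha Bb b0 mb b1 hb bA kpsi kchi) => d0.
  split; first by rewrite ea eb.
  exists (symbol a b psi chi); first exact: L2_symbol.
  move=> f; rewrite /model_space_inf ea attoE => -[kf hf].
  exact: (symbol_atto ma a1 ha Hbeta Bb mb b1 hb bA kpsi kchi d0).
Qed.
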